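(* Work on $\mathbb{R}^d$ with coordinates $x^\mu$ and smooth fields (non-singular at $x=0$). The map $e\mapsto g$, $g_{\mu\nu}=e^a_\mu e^a_\nu$, is a bijection from the space of vielbeins $e^a=e^a_\mu dx^\mu$ satisfying $$x^\mu e^a_\mu(x)=x^a,\qquad x^a e^a_\mu(x)=x^\mu,\qquad i_a\mathcal L_{\mathfrak r}e^b=i_b\mathcal L_{\mathfrak r}e^a$$ onto the space of Riemannian metrics in normal coordinates, i.e. metrics with $x^\mu g_{\mu\nu}(x)=x^\nu$. Its inverse sends $g$ to the unique solution $e^a_\mu$ of $$\frac{d}{dt}e^a_\mu(tx)=\tfrac12\,e_a^{\ \nu}(tx)\,\frac{d}{dt}g_{\nu\mu}(tx),\qquad e^a_\mu(0)=\delta^a_\mu .$$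
   Context: Latin indices $a,b\in\{1,\dots,d\}$ are frame indices, Greek indices coordinate indices; frame indices are raised/lowered with $\delta_{ab}$ (Euclidean signature), repeated indices summed, and $x^a=\delta^a_\mu x^\mu$. A vielbein is a coframe $e^a=e^a_\mu dx^\mu$ (invertible matrix $e^a_\mu$); its dual vector fields are $e_a=e_a^{\ \mu}\partial_\mu$ with $e^a_\mu e_a^{\ \nu}=\delta^\nu_\mu$, and $i_a$ is the interior product with $e_a$. $\mathfrak r=x^\mu\partial_\mu$ is the radial vector field and $\mathcal L_{\mathfrak r}$ the Lie derivative along it (on a 1-form, $(\mathcal L_{\mathfrak r}\sigma)_\mu=(x^\nu\partial_\nu+1)\sigma_\mu$). *)

(* Defs.v *)
From HB Require Import structures.
From mathcomp Require Import all_boot all_order all_algebra.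
From mathcomp Require Import all_classical all_reals all_analysis.
Set Implicit Arguments. Unset Strict Implicit. Unset Printing Implicit Defensive.
Import Order.TTheory GRing.Theory Num.Theory.
Import numFieldNormedType.Exports.
Local Open Scope ring_scope.

Definition coord (R : realType) (d : nat) (x : 'rV[R]_d) (mu : 'I_d) : R :=
  x ord0 mu.

Definition basisv (R : realType) (d : nat) (i : 'I_d) : 'rV[R]_d :=
  delta_mx ord0 i.

Fixpoint Ck (R : realType) (d : nat) (k : nat) (f : 'rV[R]_d -> R) : Prop :=
  match k with
  | 0 => continuous f
  | k.+1 => [/\ continuous f,
                (forall (x : 'rV[R]_d) (i : 'I_d), derivable f x (basisv R i))
              & forall i : 'I_d, Ck k ('D_(basisv R i) f)]
  end.

Definition smooth (R : realType) (d : nat) (f : 'rV[R]_d -> R) : Prop :=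
  forall k, Ck k f.

Definition field2 (R : realType) (d : nat) := 'I_d -> 'I_d -> 'rV[R]_d -> R.

Definition emx (R : realType) (d : nat) (e : field2 R d) (x : 'rV[R]_d) : 'M[R]_d :=
  \matrix_(a, mu) e a mu x.

Definition vielbein (R : realType) (d : nat) (e : field2 R d) : Prop :=
  (forall a mu, smooth (e a mu)) /\ (forall x, emx e x \in unitmx).

(* Dual frame e_a^nu, characterized by e^a_mu e_a^nu = delta_mu^nu:
   e_a^nu = (emx e x)^{-1} nu a. *)
Definition edual (R : realType) (d : nat) (e : field2 R d) (a nu : 'I_d)
  (x : 'rV[R]_d) : R := invmx (emx e x) nu a.

(* (L_r sigma)_mu = (x^nu d_nu + 1) sigma_mu, for the 1-form e^b. *)
Definition lie_r (R : realType) (d : nat) (e : field2 R d) (b mu : 'I_d)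
  (x : 'rV[R]_d) : R := 'D_x (e b mu) x + e b mu x.

Definition iLe (R : realType) (d : nat) (e : field2 R d) (a b : 'I_d)
  (x : 'rV[R]_d) : R := \sum_mu edual e a mu x * lie_r e b mu x.

Definition good_vielbein (R : realType) (d : nat) (e : field2 R d) : Prop :=
  [/\ vielbein e,
      (forall x a, \sum_mu coord x mu * e a mu x = coord x a),
      (forall x mu, \sum_a coord x a * e a mu x = coord x mu)
    & (forall x a b, iLe e a b x = iLe e b a x)].

Definition riemannian (R : realType) (d : nat) (g : field2 R d) : Prop :=
  [/\ (forall mu nu, smooth (g mu nu)),
      (forall mu nu x, g mu nu x = g nu mu x)
    & (forall x (v : 'rV[R]_d), v != 0 ->
         0 < \sum_mu \sum_nu v ord0 mu * g mu nu x * v ord0 nu)].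

Definition normal_metric (R : realType) (d : nat) (g : field2 R d) : Prop :=
  riemannian g /\ (forall x nu, \sum_mu coord x mu * g mu nu x = coord x nu).

Definition metric_of (R : realType) (d : nat) (e : field2 R d) : field2 R d :=
  fun mu nu x => \sum_a e a mu x * e a nu x.

Definition solves_ode (R : realType) (d : nat) (g e : field2 R d) : Prop :=
  (forall a mu, e a mu 0 = (a == mu)%:R) /\
  (forall (x : 'rV[R]_d) (t : R) a mu,
     derive1 (fun s : R => e a mu (s *: x)) t =
     2^-1 * \sum_nu edual e a nu (t *: x) * derive1 (fun s : R => g nu mu (s *: x)) t).

(* Main.v *)
Require Import Defs.
From HB Require Import structures.
From mathcomp Require Import all_boot all_order all_algebra.
From mathcomp Require Import all_classical all_reals all_analysis.
From mathcomp Require Import ring lra.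
Import Order.TTheory GRing.Theory Num.Theory.
Import numFieldNormedType.Exports.
Set Implicit Arguments.
Unset Strict Implicit.
Unset Printing Implicit Defensive.
Local Open Scope ring_scope.
Local Open Scope classical_set_scope.

(* Write e, g for the matrices e^a_mu, g_{mu nu}, so that the metric of e is
   e^T e, and let ' be the derivative along the ray t |-> t x.  The symmetry
   condition says that e' e^-1 is symmetric; as g' = e'^T e + e^T e', it is
   equivalent, given g = e^T e, to the equation e' = e^-T g' / 2.  (At t = 0 the
   condition is vacuous, and one concludes by continuity.)  Conversely, a
   solution satisfies (e^T e - g)' = 0 and (e x)' = 0, because g' x = 0.

   On a solution e^-T = e g^-1, so the nonlinear equation is equivalent to the
   linear one e' = e g^-1 g' / 2, for which e g^-1 e^T is constant.  Existence
   and uniqueness thus reduce to linear systems y' = B(t, x) y, and smoothness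
   of e(x) = y(1, x) to the smooth dependence of y on the parameter x. *)

(** * Derivatives of functions of one variable *)

(** The nonlinear equation contains e^-1, so a solution could break down where e degenerates. The
    linear form is solvable for all t, and the conserved quantity e g^-1 e^T, equal to 1 at the
    origin, yields invertibility everywhere afterwards. The coefficient satisfies B(s, t x) = t B(s
    t, x), hence y(s, t x) = y(s t, x): the solutions along all rays fit together into the single
    field e(x) = y(1, x). Smoothness is defined through iterated partial derivatives, whereas the
    symmetry condition and the equation differentiate along x; continuity of the partial derivatives
    links the two. The derivative in direction t x is t times the derivative along the ray, which is
    why the symmetry condition says nothing at t = 0. *)

Lemma is_derive_sumr (K : numFieldType) (V W : normedModType K) (I : Type)
    (r : seq I) (h : I -> V -> W) (dh : I -> W) (x v : V) :
  (forall i, is_derive x v (h i) (dh i)) ->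
  is_derive x v (fun y => \sum_(i <- r) h i y) (\sum_(i <- r) dh i).
Proof.
move=> dhi; elim: r => [|i r IHr].
  rewrite big_nil; under eq_fun do rewrite big_nil.
  exact: is_derive_cst.
rewrite big_cons; under eq_fun do rewrite big_cons.
exact: is_deriveD.
Qed.

Lemma is_derive_mulr (K : numFieldType) (V : normedModType K)
    (f g : V -> K) (df dg : K) (x v : V) :
  is_derive x v f df -> is_derive x v g dg ->
  is_derive x v (fun y => f y * g y) (df * g x + f x * dg).
Proof.
move=> fx gx; apply: (is_derive_eq (is_deriveM fx gx)).
by rewrite addrC [df * _]mulrC.
Qed.

Lemma is_derive_cmul (K : numFieldType) (V : normedModType K)
    (c : K) (f : V -> K) (df : K) (x v : V) :
  is_derive x v f df -> is_derive x v (fun y => c * f y) (c * df).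
Proof.
move=> fx; apply: (is_derive_eq (is_derive_mulr (is_derive_cst c x v) fx)).
by rewrite mul0r add0r.
Qed.

Lemma is_derive_linear (K : numFieldType) (c x : K) :
  is_derive x 1 (fun y : K => c * y) c.
Proof.
by apply: (is_derive_eq (is_derive_cmul c (is_derive_id x 1))); rewrite mulr1.
Qed.

Lemma is_derive_addr (K : numFieldType) (V W : normedModType K)
    (f g : V -> W) (df dg : W) (x v : V) :
  is_derive x v f df -> is_derive x v g dg ->
  is_derive x v (fun y => f y + g y) (df + dg).
Proof. exact: is_deriveD. Qed.

Lemma is_derive_subr (K : numFieldType) (V W : normedModType K)
    (f g : V -> W) (df dg : W) (x v : V) :
  is_derive x v f df -> is_derive x v g dg ->
  is_derive x v (fun y => f y - g y) (df - dg).
Proof. exact: is_deriveB. Qed.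

Lemma is_derive_continuous (K : numFieldType) (V : normedModType K)
    (f : K -> V) (x : K) (df : V) :
  is_derive x 1 f df -> {for x, continuous f}.
Proof. by move=> [? _]; apply/differentiable_continuous/derivable1_diffP. Qed.

Section OneVariable.
Context {R : realType}.
Implicit Types (f g : R -> R) (a b s t x T : R).

Lemma is_derive_oppc f x df :
  is_derive (- x) 1 f df -> is_derive x 1 (fun t => f (- t)) (- df).
Proof.
move=> fx.
apply: (is_derive_eq (@is_derive1_comp R f -%R x df (-1) fx _)).
by rewrite mulrN1.
Qed.

Lemma le_increment f f' a b : a <= b ->
  (forall s, a <= s <= b -> is_derive s 1 f (f' s)) ->
  (forall s, a <= s <= b -> 0 <= f' s) -> f a <= f b.
Proof.
move=> ab fd f0; rewrite -subr_ge0.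
have [s| |c] := @MVT_segment R f f' a b ab.
- by rewrite in_itv/= => /andP[/ltW as_ /ltW sb]; apply: fd; rewrite as_.
- apply: derivable_within_continuous => s; rewrite in_itv /= => sab.
  exact: (@ex_derive _ _ _ _ _ _ _ (fd _ sab)).
- by rewrite in_itv /= => cab ->; rewrite mulr_ge0 ?subr_ge0// f0.
Qed.

(** Both [p + w] and [p - w] are nondecreasing, their derivatives being nonnegative. *)
Lemma norm_increment_le (w w' p p' : R -> R) T : 0 <= T ->
  (forall s, 0 <= s <= T -> is_derive s 1 w (w' s)) ->
  (forall s, 0 <= s <= T -> is_derive s 1 p (p' s)) ->
  (forall s, 0 <= s <= T -> `|w' s| <= p' s) ->
  `|w T - w 0| <= p T - p 0.
Proof.
move=> T0 dw dp wp; rewrite ler_norml; apply/andP; split.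
- have := @le_increment (p + w) (p' + w') 0 T T0.
  have H : forall s, 0 <= s <= T -> is_derive s 1 (p + w) ((p' + w') s).
    by move=> s sT; apply: is_deriveD; [exact: dp|exact: dw].
  move=> /(_ H); rewrite [(p + w) 0]/(p 0 + w 0) [(p + w) T]/(p T + w T) => H'.
  suff : p 0 + w 0 <= p T + w T by lra.
  apply: H' => s sT; have := wp _ sT; rewrite ler_norml => /andP[wps _].
  by change (0 <= p' s + w' s); rewrite addrC -lerBlDr sub0r.
- have := @le_increment (p - w) (p' - w') 0 T T0.
  have H : forall s, 0 <= s <= T -> is_derive s 1 (p - w) ((p' - w') s).
    by move=> s sT; apply: is_deriveB; [exact: dp|exact: dw].
  move=> /(_ H); rewrite [(p - w) 0]/(p 0 - w 0) [(p - w) T]/(p T - w T) => H'.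
  suff : p 0 - w 0 <= p T - w T by lra.
  apply: H' => s sT; have := wp _ sT; rewrite ler_norml => /andP[_ wps].
  by change (0 <= p' s - w' s); rewrite subr_ge0.
Qed.

(** Negative times follow by reflecting [w]. The majorant is composed with [|t|] only in the
    conclusion, so that [p] itself stays differentiable at 0. *)
Lemma norm_increment_le_sym (w w' p p' : R -> R) T :
  (forall s, `|s| <= T -> is_derive s 1 w (w' s)) ->
  (forall s, is_derive s 1 p (p' s)) ->
  (forall s, `|s| <= T -> `|w' s| <= p' `|s|) ->
  forall t, `|t| <= T -> `|w t - w 0| <= p `|t| - p 0.
Proof.
move=> dw dp wp t tT; have [t0|t0] := leP 0 t.
  rewrite (ger0_norm t0) in tT *.
  apply: (@norm_increment_le w w' p p' t) => // s /andP[s0 st].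
  - by apply: dw; rewrite ger0_norm// (le_trans st).
  - by rewrite -[s in p' s]ger0_norm// wp// ger0_norm// (le_trans st).
have t0' : 0 <= - t by rewrite oppr_ge0 ltW.
rewrite (ltr0_norm t0) in tT *.
have := @norm_increment_le (fun s => w (- s)) (fun s => - w' (- s)) p p' _ t0'.
rewrite opprK oppr0; apply.
- move=> s /andP[s0 st]; apply/is_derive_oppc/dw.
  by rewrite normrN ger0_norm// (le_trans st).
- move=> s /andP[s0 st]; rewrite normrN -[s in p' s]ger0_norm// -[`|s|]normrN wp//.
  by rewrite normrN ger0_norm// (le_trans st).
Qed.

Lemma continuous_bounded_segment f T : continuous f ->
  exists M, forall t, `|t| <= T -> `|f t| <= M.
Proof.
move=> cf; have [T0|T0] := leP 0 T; last first.
  by exists 0 => t tT; have := normr_ge0 t; lra.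
have [|c _ cmax] := @EVT_max R (fun t => `|f t|) (- T) T ltac:(lra).
  apply: continuous_subspaceT => t.
  exact: (continuous_comp (cf t) (@norm_continuous _ _ _)).
by exists `|f c| => t; rewrite ler_norml => tT; apply: cmax; rewrite in_itv.
Qed.

(* The integral from -oo is used because [continuous_FTC1] then applies at
   every point; it converges since f vanishes on the negative axis. *)
Lemma primitive_right f : continuous f -> (forall x, x <= 0 -> f x = 0) ->
  exists F, forall x, is_derive x 1 F (f x).
Proof.
move=> cf f0.
exists (fun x => (\int[lebesgue_measure]_(t in [set` `]-oo, x]]) f t)%R) => x.
have := @continuous_FTC1 R f -oo%O x (x + 1) ltac:(lra).
move=> /(_ _ _ (cf x)) H.
suff /H/(_ (ltNyr _))[F1 F2] : lebesgue_measure.-integrable `]-oo, (x + 1)] (EFin \o f).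
  by apply: DeriveDef; [exact: F1|rewrite -derive1E; exact: F2].
have mA : measurable (`]-oo, (x + 1)] : set (measurableTypeR R)) by [].
apply/(integrable_mkcond _ mA).
have mB : measurable (`[0, (x + 1)] : set (measurableTypeR R)) by [].
have -> : (EFin \o f) \_ `]-oo, (x + 1)] = (EFin \o f) \_ `[0, (x + 1)].
  apply/funext => t; rewrite !patchE /=.
  rewrite !mem_setE !in_itv /=.
  have [t0|t0] /= := leP 0 t; first by [].
  by case: ifP => // _; rewrite f0// ltW.
apply/(integrable_mkcond _ mB); apply: continuous_compact_integrable.
  exact: segment_compact.
exact: continuous_subspaceT.
Qed.

Lemma continuous_primitive f : continuous f ->
  exists F, F 0 = 0 /\ forall x, is_derive x 1 F (f x).
Proof.
move=> cf.
have [|x x0|F Fd] := @primitive_right (fun x => f (Num.max x 0) - f 0).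
- move=> x; apply: cvgB; last exact: cvg_cst.
  apply: (@continuous_comp _ _ _ (fun x : R => Num.max x 0) f); last exact: cf.
  by apply: continuous_max; [exact: cvg_id|exact: cvg_cst].
- by rewrite max_r// subrr.
have [|x x0|G Gd] := @primitive_right (fun x => f (- Num.max x 0) - f 0).
- move=> x; apply: cvgB; last exact: cvg_cst.
  apply: (@continuous_comp _ _ _ (fun x : R => - Num.max x 0) f); last exact: cf.
  by apply: cvgN; apply: continuous_max; [exact: cvg_id|exact: cvg_cst].
- by rewrite max_r// oppr0 subrr.
(* [F] and [G] integrate [f - f 0] over the positive and the reflected negative half-line; the
   constant [f 0] is put back as a linear term. *)
pose P x := F x - G (- x) + f 0 * x.
exists (fun x => P x - P 0); split; first by rewrite subrr.
move=> x.
have dP : is_derive x 1 P (f (Num.max x 0) - f 0 -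
    (- (f (- Num.max (- x) 0) - f 0)) + f 0).
  apply: is_derive_addr.
    exact: (is_derive_subr (Fd x) (is_derive_oppc (Gd (- x)))).
  exact: is_derive_linear.
apply: (is_derive_eq (is_derive_subr dP (is_derive_cst (P 0) x 1))).
rewrite subr0 opprK; have [x0|x0] := leP 0 x.
- by rewrite max_r ?oppr_le0// oppr0; lra.
- by rewrite max_l ?oppr_ge0 1?ltW// opprK; lra.
Qed.

End OneVariable.

(** * Gronwall estimate *)

Section FastConvergence.
Context {R : realType}.

Lemma half_pow_lt (c e : R) : 0 < e -> exists n, c * 2^-1 ^+ n < e.
Proof.
move=> e0; have H : `|2^-1 : R| < 1 by rewrite ger0_norm; lra.
have /cvgrPdist_lt /(_ _ e0) [n _ /(_ n (leqnn n))] := cvg_geometric c H.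
by rewrite /= /geometric /= sub0r normrN => /(le_lt_trans (ler_norm _)); exists n.
Qed.

Lemma half_pow_eq0 (a c : R) : (forall n, `|a| <= c * 2^-1 ^+ n) -> a = 0.
Proof.
move=> ac; apply/eqP; rewrite -normr_le0 leNgt; apply/negP => a0.
have [n] := half_pow_lt c a0; by rewrite ltNge ac.
Qed.

(** With h n = 2 c 2^-n one has h n - h (n+1) = c 2^-n, so u + h decreases, u - h increases, and
    their common limit lies between them. *)
Lemma fast_cauchy (u : nat -> R) (c : R) :
  (forall n, `|u n.+1 - u n| <= c * 2^-1 ^+ n) ->
  forall n, `|limn u - u n| <= 2 * c * 2^-1 ^+ n.
Proof.
move=> uc.
pose h n : R := 2 * c * 2^-1 ^+ n.
have hS n : h n - h n.+1 = c * 2^-1 ^+ n by rewrite /h exprS; field.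
pose a n : R := u n + h n; pose b n : R := u n - h n.
have c0 : 0 <= c by have := uc 0%N; rewrite expr0 mulr1; apply: le_trans.
have h0 n : 0 <= h n by rewrite /h !mulr_ge0// exprn_ge0.
have ba : {homo a : n m / (n <= m)%N >-> m <= n}.
  apply/nonincreasing_seqP => n; have := uc n; rewrite -hS ler_norml => /andP[_].
  by rewrite /a; lra.
have bb : {homo b : n m / (n <= m)%N >-> n <= m}.
  apply/nondecreasing_seqP => n; have := uc n; rewrite -hS ler_norml => /andP[+ _].
  by rewrite /b; lra.
have ca : cvgn a.
  apply: nonincreasing_is_cvgn => //; exists (b 0%N) => _ [n _ <-].
  by apply: (le_trans (bb 0%N n (leq0n n))); rewrite /a /b; have := h0 n; lra.
have ch : h @ \oo --> (0 : R).
  by apply: cvg_geometric; rewrite ger0_norm; lra.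
have ua : u = a - h by apply/funext => n; rewrite /a /= fctE addrK.
have ub : b = a - h - h by apply/funext => n; rewrite -ua.
have lu : limn u = limn a.
  rewrite ua; apply/cvg_lim => //.
  by rewrite -[X in _ --> X]subr0; apply: cvgB.
have lb : b @ \oo --> limn a.
  by rewrite ub -[X in _ --> X]subr0; apply: cvgB => //;
     rewrite -[X in _ --> X]subr0; apply: cvgB.
move=> n; rewrite lu ler_distl; apply/andP; split.
  have cb : cvgn b by apply/cvg_ex; eexists; exact: lb.
  by have := nondecreasing_cvgn_le bb cb n; rewrite (cvg_lim _ lb).
exact: nonincreasing_cvgn_ge ba ca n.
Qed.

(** Convergence is uniform on bounded intervals, so the usual three-term estimate applies. *)
Lemma continuous_fast_limit (y : R -> R) (u : nat -> R -> R) :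
  (forall n, continuous (u n)) ->
  (forall T, exists E, forall n t, `|t| <= T -> `|y t - u n t| <= E * 2^-1 ^+ n) ->
  continuous y.
Proof.
move=> cu yu t; apply/cvgrPdist_lt => e e0.
have [E HE] := yu (`|t| + 1).
have [n En] := @half_pow_lt E (e / 3) ltac:(by rewrite divr_gt0).
have e3 : 0 < e / 3 by rewrite divr_gt0.
have /cvgrPdist_lt /(_ _ e3) cut := cu n t.
near=> s.
have st : `|s| <= `|t| + 1.
  have : `|t - s| < 1.
    by near: s; exact: (@cvgr_dist_lt _ _ _ _ (nbhs_filter t) id t cvg_id 1 ltr01).
  have := ler_normB t (t - s); rewrite subKr; lra.
have H1 := HE n t ltac:(lra).
have H2 := HE n s st.
have H3 : `|u n t - u n s| < e / 3 by near: s.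
rewrite distrC in H2.
have -> : y t - y s = (y t - u n t) + (u n t - u n s) + (u n s - y s) by ring.
apply: (le_lt_trans (ler_normD _ _)).
have := ler_normD (y t - u n t) (u n t - u n s).
lra.
Unshelve. all: by end_near. Qed.

End FastConvergence.

(** * The differential inequality for finite systems *)

Section LinearSystem.
Context {R : realType} {J : finType}.
Implicit Types (B : J -> J -> R -> R) (y : J -> R -> R).

Definition linear_solution B y :=
  forall j (t : R), is_derive t 1 (y j) (\sum_k B j k t * y k t).

(** The square root undoes the passage to the sum of squares phi, for which phi(T) <= n eps^2 T
    exp((2 n M + 1) T) with n the size of [J]. *)
Definition gronwall_bound (M T : R) : R :=
  Num.sqrt (#|J|%:R * T * expR ((2 * #|J|%:R * M + 1) * T)).

(** The sum of squares replaces the sum of absolute values because it is differentiable. *)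
Lemma gronwall_right (M T eps : R) (w w' : J -> R -> R) :
  0 <= M -> 0 <= T -> 0 <= eps -> (forall j, w j 0 = 0) ->
  (forall j (s : R), 0 <= s <= T -> is_derive s 1 (w j) (w' j s)) ->
  (forall j s, 0 <= s <= T -> `|w' j s| <= M * (\sum_k `|w k s|) + eps) ->
  forall j, `|w j T| <= eps * gronwall_bound M T.
Proof.
move=> M0 T0 eps0 w0 dw ww j.
pose n : R := #|J|%:R; pose K := 2 * n * M + 1.
pose phi s := \sum_j w j s * w j s.
(* phi' <= K phi + n eps^2, so n eps^2 s - phi(s) exp(- K s) is nondecreasing. *)
have dphi (s : R) : 0 <= s <= T ->
    is_derive s 1 phi (\sum_j (w' j s * w j s + w j s * w' j s)).
  by move=> sT; apply: is_derive_sumr => i; apply: is_derive_mulr; exact: dw.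
have dexp (s : R) : is_derive s 1 (fun s => expR (- K * s)) (expR (- K * s) * (- K)).
  apply: (@is_derive1_comp _ expR (fun s => - K * s)).
  exact: is_derive_linear.
have n0 : 0 <= n by rewrite ler0n.
(* The cross terms are split by 2ab <= a^2 + b^2; summed over i this gives the 2 n M and the 1 in
   [K]. *)
have bound s i : 0 <= s <= T -> w' i s * w i s + w i s * w' i s <=
    M * (n * (w i s * w i s) + phi s) + w i s * w i s + eps * eps.
  move=> sT; have := ww i s sT.
  set S := \sum_k _ => wS.
  have S0 : 0 <= S by apply: sumr_ge0.
  have H1 : w' i s * w i s <= `|w i s| * (M * S + eps).
    rewrite (le_trans (ler_norm _))// normrM mulrC ler_wpM2l//.
  have H2 : 2 * (`|w i s| * S) <= n * (w i s * w i s) + phi s.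
    have -> : n * (w i s * w i s) + phi s = \sum_k (w i s * w i s + w k s * w k s).
      by rewrite big_split /= sumr_const mulr_natl.
    rewrite mulrA mulr_sumr; apply: ler_sum => k _.
    have := sqr_ge0 (`|w i s| - `|w k s|).
    have := real_normK (num_real (w i s)); have := real_normK (num_real (w k s)).
    by nra.
  have H3 : 2 * (`|w i s| * eps) <= w i s * w i s + eps * eps.
    have := sqr_ge0 (`|w i s| - eps).
    have := real_normK (num_real (w i s)).
    by nra.
  have := ler_wpM2l M0 H2; nra.
have dbound s : 0 <= s <= T ->
    \sum_j (w' j s * w j s + w j s * w' j s) <= K * phi s + n * (eps * eps).
  move=> sT; apply: (le_trans (ler_sum _ (fun i _ => bound s i sT))).
  rewrite !big_split /= -mulr_sumr big_split /= -mulr_sumr !sumr_const -/(phi s).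
  rewrite -[phi s *+ _]mulr_natl -[(eps * eps) *+ _]mulr_natl -/n /K.
  by rewrite le_eqVlt; apply: predU1l; ring.
have := @le_increment R
  (fun s => n * (eps * eps) * s - phi s * expR (- K * s))
  (fun s => n * (eps * eps) -
     ((\sum_j (w' j s * w j s + w j s * w' j s)) * expR (- K * s)
      + phi s * (expR (- K * s) * - K))) 0 T T0.
have -> : phi 0 = 0.
  by apply: big1 => i _; rewrite w0 mul0r.
rewrite mulr0 mul0r subrr => H.
have {H} : 0 <= n * (eps * eps) * T - phi T * expR (- K * T).
  apply: H => s sT.
    exact: is_derive_subr (is_derive_linear _ s) (is_derive_mulr (dphi s sT) (dexp s)).
  set D := \sum_j _; have := dbound s sT; rewrite -/D => DB.
  have E0 := expR_gt0 (- K * s).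
  have E1 : expR (- K * s) <= 1.
    rewrite -expR0 ler_expR mulNr oppr_le0 mulr_ge0//; last by case/andP: sT.
    by rewrite /K addr_ge0// !mulr_ge0.
  have ne : 0 <= n * (eps * eps) by rewrite !mulr_ge0.
  have := ler_wpM2r (ltW E0) DB; nra.
rewrite subr_ge0 => H.
have {}H : phi T <= eps ^+ 2 * (n * T * expR (K * T)).
  have := ler_wpM2r (expR_ge0 (K * T)) H.
  rewrite -[phi T * _ * _]mulrA -expRD mulNr addNr expR0 mulr1 => /le_trans; apply.
  by rewrite le_eqVlt; apply: predU1l; ring.
have X0 : 0 <= n * T * expR (K * T) by rewrite !mulr_ge0// expR_ge0.
rewrite -(ler_pXn2r (ltn0Sn 1)) ?nnegrE ?mulr_ge0 ?sqrtr_ge0//.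
rewrite exprMn [gronwall_bound _ _ ^+ 2]sqr_sqrtr// real_normK ?num_real//.
apply: le_trans H; rewrite /phi (bigD1 j)//= -expr2 lerDl.
by apply: sumr_ge0 => i _; rewrite -expr2 sqr_ge0.
Qed.

Lemma gronwall_boundS (M T t : R) : 0 <= M -> 0 <= t <= T ->
  gronwall_bound M t <= gronwall_bound M T.
Proof.
move=> M0 /andP[t0 tT]; have T0 : 0 <= T by lra.
have n0 : 0 <= #|J|%:R :> R by rewrite ler0n.
rewrite ler_wsqrtr// ler_pM ?mulr_ge0 ?expR_ge0 ?ler_wpM2l//.
by rewrite ler_expR ler_wpM2l// addr_ge0// !mulr_ge0.
Qed.

(** The case eps = 0 gives uniqueness; small eps gives continuity and differentiability in a
    parameter, eps measuring the perturbation of the system. Negative times come from time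
    reversal. *)
Lemma gronwall (M T eps : R) (w w' : J -> R -> R) :
  0 <= M -> 0 <= eps -> (forall j, w j 0 = 0) ->
  (forall j (s : R), `|s| <= T -> is_derive s 1 (w j) (w' j s)) ->
  (forall j s, `|s| <= T -> `|w' j s| <= M * (\sum_k `|w k s|) + eps) ->
  forall j t, `|t| <= T -> `|w j t| <= eps * gronwall_bound M T.
Proof.
move=> M0 eps0 w0 dw ww j t tT.
apply: (@le_trans _ _ (eps * gronwall_bound M `|t|)); last first.
  by rewrite ler_wpM2l// gronwall_boundS// normr_ge0.
have [t0|t0] := leP 0 t.
  have := tT; rewrite (ger0_norm t0) => tT'.
  apply: (@gronwall_right M t eps w w') => // [i s|i s] /andP[s0 st].
  - by apply: dw; rewrite ger0_norm// (le_trans st).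
  - by apply: ww; rewrite ger0_norm// (le_trans st).
have := tT; rewrite (ltr0_norm t0) => tT'.
have t0' : 0 <= - t by rewrite oppr_ge0 ltW.
have := @gronwall_right M (- t) eps (fun i s => w i (- s))
  (fun i s => - w' i (- s)) M0 t0' eps0.
rewrite opprK; apply => [i|i s /andP[s0 st]|i s /andP[s0 st]].
- by rewrite oppr0.
- apply/is_derive_oppc/dw; by rewrite normrN ger0_norm// (le_trans st).
- by rewrite normrN ww// normrN ger0_norm// (le_trans st).
Qed.

End LinearSystem.

(** * Existence and uniqueness for linear systems *)

Lemma cvg_sumr (K : numFieldType) (V : normedModType K) (T I : Type)
    (F : set_system T) (FF : Filter F) (r : seq I) (h : I -> T -> V) (l : I -> V) :
  (forall i, h i x @[x --> F] --> l i) ->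
  (\sum_(i <- r) h i x) @[x --> F] --> \sum_(i <- r) l i.
Proof.
move=> hl; elim: r => [|i r IHr].
  by rewrite big_nil; under eq_fun do rewrite big_nil; exact: cvg_cst.
by rewrite big_cons; under eq_fun do rewrite big_cons; exact: cvgD.
Qed.

Section LinearExistence.
Context {R : realType} {J : finType}.
Implicit Types (B : J -> J -> R -> R) (y : J -> R -> R).

Lemma continuous_matrix_bounded B (T : R) :
  (forall j k, continuous (B j k)) ->
  exists M : R, 0 <= M /\ forall j k (t : R), `|t| <= T -> `|B j k t| <= M.
Proof.
move=> cB.
have /choice [m Hm] : forall jk : J * J,
    exists M, forall t, `|t| <= T -> `|B jk.1 jk.2 t| <= M.
  by move=> jk; apply: continuous_bounded_segment.
exists (\sum_jk `|m jk|); split; first exact: sumr_ge0.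
move=> j k t tT; apply: (le_trans (Hm (j, k) t tT)).
rewrite (bigD1 (j, k))//=; apply: (le_trans (ler_norm _)).
by rewrite lerDl; apply: sumr_ge0.
Qed.

Lemma linear_rhs_le B (v : J -> R) (M A s : R) : 0 <= M ->
  (forall j k, `|B j k s| <= M) -> (forall k, `|v k| <= A) ->
  forall j, `|\sum_k B j k s * v k| <= #|J|%:R * (M * A).
Proof.
move=> M0 BM vA j; rewrite mulr_natl -sumr_const.
apply: (le_trans (ler_norm_sum _ _ _)); apply: ler_sum => k _.
by rewrite normrM ler_pM.
Qed.

Lemma continuous_rhs B y : (forall j k, continuous (B j k)) ->
  (forall k, continuous (y k)) ->
  forall j, continuous (fun t => \sum_k B j k t * y k t).
Proof.
move=> cB cy j t; apply: cvg_sumr => k.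
by apply: cvgM; [exact: cB|exact: cy].
Qed.

Section Picard.
Variables (B : J -> J -> R -> R) (c : J -> R).
Hypothesis cB : forall j k, continuous (B j k).

(** The Picard iterates enter only through their initial values and derivatives, so that all
    estimates go through the mean value inequality. *)
Variable u : nat -> J -> R -> R.
Hypothesis u0 : forall j t, u 0%N j t = c j.
Hypothesis uc : forall n j, u n j 0 = c j.
Hypothesis ud : forall n j (t : R),
  is_derive t 1 (u n.+1 j) (\sum_k B j k t * u n k t).

Let y (j : J) (t : R) : R := limn (fun n => u n j t).

Lemma picard_continuous n j : continuous (u n j).
Proof.
case: n => [|n] t; last exact: is_derive_continuous (ud n j t).
have -> : u 0%N j = fun=> c j by apply/funext => s; rewrite u0.
exact: cvg_cst.
Qed.

(* The weight [expR (K * `|t|)] makes the Picard map a 1/2-contraction. *)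
Lemma picard_cvg (T : R) :
  exists E, forall n j t, `|t| <= T -> `|y j t - u n j t| <= E * 2^-1 ^+ n.
Proof.
have [M [M0 BM]] := continuous_matrix_bounded T cB.
pose K := 2 * #|J|%:R * M + 1; pose C := \sum_j `|c j|.
have C0 : 0 <= C by apply: sumr_ge0.
have n0 : 0 <= #|J|%:R :> R by rewrite ler0n.
have K1 : 1 <= K by rewrite /K lerDr !mulr_ge0.
(* As K >= 2 n M, the bound n M A exp(K |s|) on the right-hand side is at most the derivative of (A
   / 2) exp(K s) taken at |s|. *)
have step (w v : J -> R -> R) (A : R) : 0 <= A ->
    (forall j, w j 0 = 0) ->
    (forall j (t : R), is_derive t 1 (w j) (\sum_k B j k t * v k t)) ->
    (forall j (t : R), `|t| <= T -> `|v j t| <= A * expR (K * `|t|)) ->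
    forall j (t : R), `|t| <= T -> `|w j t| <= A / 2 * expR (K * `|t|).
  move=> A0 w0 dw vA j t tT.
  have := @norm_increment_le_sym R (w j) (fun t => \sum_k B j k t * v k t)
    (fun s => A / 2 * expR (K * s)) (fun s => A / 2 * (expR (K * s) * K)) T.
  move=> /(_ (fun s _ => dw j s)) H.
  have {}H : `|w j t - w j 0| <= A / 2 * expR (K * `|t|) - A / 2 * expR (K * 0).
    apply: H => // [s|s sT].
      apply: is_derive_cmul.
      exact: (@is_derive1_comp _ expR _ s _ _ (is_derive_expR _) (is_derive_linear K s)).
    have BMs := fun j k => BM j k s sT; have vAs := fun k => vA k s sT.
    apply: (le_trans (linear_rhs_le M0 BMs vAs j)).
    have := expR_ge0 (K * `|s|); set ex := expR _ => ex0.
    have : 0 <= A * ex by rewrite mulr_ge0.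
    rewrite /K; nra.
  rewrite w0 subr0 in H; apply: (le_trans H).
  by rewrite gerBl mulr_ge0 ?expR_ge0// divr_ge0.
have exp1 (t : R) : 1 <= expR (K * `|t|).
  by rewrite -expR0 ler_expR mulr_ge0//; lra.
have du n : forall j (t : R), `|t| <= T ->
    `|u n.+1 j t - u n j t| <= C * 2^-1 ^+ n * expR (K * `|t|).
  elim: n => [|n IHn] j t tT.
    rewrite expr0 mulr1; apply: le_trans (_ : C / 2 * expR (K * `|t|) <= _).
      apply: (step (fun j t => u 1 j t - u 0 j t) (u 0%N)) => //.
      - by move=> i; rewrite !uc subrr.
      - move=> i s; have -> : u 0%N i = fun=> c i by apply/funext => s'; rewrite u0.
        apply: (is_derive_eq (is_derive_subr (ud 0 i s) (is_derive_cst (c i) s 1))).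
        by rewrite subr0.
      - move=> i s _; rewrite u0; apply: (@le_trans _ _ C).
          by rewrite /C (bigD1 i)//= lerDl; apply: sumr_ge0.
        by have := exp1 s; nra.
    rewrite ler_wpM2r ?expR_ge0//; lra.
  have -> : C * 2^-1 ^+ n.+1 = C * 2^-1 ^+ n / 2 by rewrite exprSr mulrA.
  apply: (step (fun j t => u n.+2 j t - u n.+1 j t)
    (fun j t => u n.+1 j t - u n j t)) => //.
  - by rewrite mulr_ge0// exprn_ge0.
  - by move=> i; rewrite !uc subrr.
  - move=> i s; apply: (is_derive_eq (is_derive_subr (ud n.+1 i s) (ud n i s))).
    by rewrite -sumrB; apply: eq_bigr => k _; rewrite mulrBr.
exists (2 * (C * expR (K * T))) => n j t tT.
apply: fast_cauchy => m; apply: (le_trans (du m j t tT)).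
rewrite mulrAC ler_wpM2r ?exprn_ge0// ler_wpM2l//.
by rewrite ler_expR ler_wpM2l//; lra.
Qed.

(** The limit [y] is continuous, so its right-hand side has a primitive [Y]. Both [Y + c] and [y]
    are within a constant times 2^-n of the iterate n + 1, hence they agree. *)
Lemma picard_solution : (forall j, y j 0 = c j) /\ linear_solution B y.
Proof.
have cy j : continuous (y j).
  apply: (@continuous_fast_limit _ _ (fun n => u n j)) => [n|T].
    exact: picard_continuous.
  by have [E HE] := picard_cvg T; exists E => n t; exact: HE.
have y0 j : y j 0 = c j.
  rewrite /y; under eq_fun do rewrite uc.
  exact: lim_cst.
split => // j.
have [Y [Y0 dY]] := continuous_primitive (@continuous_rhs B y cB cy j).
suff <- : (fun t => Y t + c j) = y j.
  move=> t; rewrite -[X in is_derive _ _ _ X]addr0.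
  exact: is_derive_addr (dY t) (is_derive_cst (c j) t 1).
apply/funext => t; apply/eqP; rewrite -subr_eq0; apply/eqP.
have [E HE] := picard_cvg `|t|.
have [M [M0 BM]] := continuous_matrix_bounded `|t| cB.
apply: (@half_pow_eq0 _ _ (#|J|%:R * (M * E) * `|t| + E)) => n.
have H1 : `|Y t + c j - u n.+1 j t| <= #|J|%:R * (M * (E * 2^-1 ^+ n)) * `|t|.
  have := @norm_increment_le_sym R (fun t => Y t + c j - u n.+1 j t)
    (fun s => \sum_k B j k s * (y k s - u n k s))
    (fun s => #|J|%:R * (M * (E * 2^-1 ^+ n)) * s)
    (fun s => #|J|%:R * (M * (E * 2^-1 ^+ n))) `|t|.
  move=> /(_ _ _ _ t (lexx _)); rewrite Y0 add0r uc subrr !subr0 mulr0 subr0; apply.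
  - move=> s _.
    apply: (is_derive_eq (is_derive_subr (is_derive_addr (dY s)
      (is_derive_cst (c j) s 1)) (ud n j s))).
    by rewrite addr0 -sumrB; apply: eq_bigr => k _; rewrite mulrBr.
  - move=> s; exact: is_derive_linear.
  - by move=> s st; apply: linear_rhs_le => // [i k|k]; [exact: BM|exact: HE].
have H2 := HE n.+1 j t (lexx _).
have -> : Y t + c j - y j t = (Y t + c j - u n.+1 j t) - (y j t - u n.+1 j t) by ring.
apply: (le_trans (ler_normB _ _)).
rewrite mulrDl; apply: lerD.
  by apply: (le_trans H1); rewrite le_eqVlt; apply: predU1l; ring.
apply: (le_trans H2); rewrite exprS.
have E0 : 0 <= E by have := HE 0%N j t (lexx _); rewrite expr0 mulr1; exact: le_trans.
by rewrite ler_wpM2l// ler_piMl ?exprn_ge0//; lra.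
Qed.

End Picard.

Theorem linear_solution_exists B (c : J -> R) :
  (forall j k, continuous (B j k)) ->
  exists y, (forall j, y j 0 = c j) /\ linear_solution B y.
Proof.
move=> cB.
(* For discontinuous f the value of [prim] is a default; every iterate is continuous, so the default
   is never met. *)
have /choice [prim primP] : forall f : R -> R, exists F : R -> R, continuous f ->
    F 0 = 0 /\ forall x : R, is_derive x 1 F (f x).
  move=> f; have [cf|ncf] := pselect (continuous f); last by exists f.
  by have [F FP] := continuous_primitive cf; exists F.
pose u := fix u n : J -> R -> R := if n is n'.+1 then
  (fun j t => c j + prim (fun s => \sum_k B j k s * u n' k s) t) else (fun j _ => c j).
have cu n : forall j, continuous (u n j).
  elim: n => [|n IHn] j t; first exact: cvg_cst.
  have [_ d] := primP _ (@continuous_rhs B (u n) cB IHn j).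
  exact: is_derive_continuous (is_derive_addr (is_derive_cst (c j) t 1) (d t)).
eexists; apply: (@picard_solution B c cB u) => // n j.
  case: n => [//|n]; rewrite /=.
  by have [-> _] := primP _ (@continuous_rhs B (u n) cB (cu n) j); rewrite addr0.
move=> t; have [_ d] := primP _ (@continuous_rhs B (u n) cB (cu n) j).
by apply: (is_derive_eq (is_derive_addr (is_derive_cst (c j) t 1) (d t))); rewrite add0r.
Qed.

(** The difference of two solutions satisfies the Gronwall hypothesis with eps = 0. *)
Lemma linear_solution_unique B (y z : J -> R -> R) :
  (forall j k, continuous (B j k)) ->
  linear_solution B y -> linear_solution B z ->
  (forall j, y j 0 = z j 0) -> y = z.
Proof.
move=> cB dy dz yz; apply/funext => j; apply/funext => t.
have [M [M0 BM]] := continuous_matrix_bounded `|t| cB.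
have := @gronwall R J M `|t| 0 (fun j s => y j s - z j s)
  (fun j s => \sum_k B j k s * (y k s - z k s)) M0 (lexx _).
move=> H; apply/eqP; rewrite -subr_eq0 -normr_le0.
rewrite -(mul0r (@gronwall_bound R J M `|t|)); apply: H => //.
- by move=> i; rewrite yz subrr.
- move=> i s _; apply: (is_derive_eq (is_derive_subr (dy i s) (dz i s))).
  by rewrite -sumrB; apply: eq_bigr => k _; rewrite mulrBr.
- move=> i s st; rewrite addr0 mulr_sumr.
  apply: (le_trans (ler_norm_sum _ _ _)); apply: ler_sum => k _.
  by rewrite normrM ler_wpM2r// BM.
Qed.

End LinearExistence.

(** * Joint continuity in time and parameter *)

Section Lines.
Context {R : realType} {V : normedModType R}.

(** The two difference quotients are the same function of h, so existence and value of the
    derivative transfer together. *)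
Lemma is_derive_line (f : V -> R) (x v : V) (s df : R) :
  is_derive s 1 (fun h : R => f (h *: v + x)) df <-> is_derive (s *: v + x) v f df.
Proof.
have E : (fun h : R => h^-1 *: (((fun h : R => f (h *: v + x)) \o shift s) (h *: (1 : R))
    - f (s *: v + x))) = (fun h : R => h^-1 *: ((f \o shift (s *: v + x)) (h *: v)
    - f (s *: v + x))).
  by apply/funext => h /=; rewrite [h *: 1]mulr1 scalerDl addrA.
by split=> -[]; rewrite /derivable /derive ?E => d1 d2; split;
   rewrite /derivable /derive ?E.
Qed.

Lemma is_derive_ray (f : V -> R) (x : V) (s df : R) :
  is_derive s 1 (fun h : R => f (h *: x)) df <-> is_derive (s *: x) x f df.
Proof.
have := is_derive_line f 0 x s df; rewrite addr0.
by under eq_fun do rewrite addr0.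
Qed.

Lemma is_derive_scaled (f : V -> R) (x v : V) (t df : R) :
  is_derive (t *: x) v f df -> is_derive x v (fun y => f (t *: y)) (t * df).
Proof.
rewrite -{1}[t *: x]add0r -(scale0r v) => /is_derive_line fx.
rewrite -{1}[x]add0r -(scale0r v); apply/is_derive_line.
have -> : (fun h : R => f (t *: (h *: v + x))) =
    (fun h => f (h *: v + t *: x)) \o (fun h => t * h).
  by apply/funext => h /=; rewrite scalerDr scalerA.
have dt : is_derive (0 : R) 1 (fun h => t * h) t.
  exact: is_derive_linear.
have fx' : is_derive (t * 0) 1 (fun h : R => f (h *: v + t *: x)) df by rewrite mulr0.
by rewrite mulrC; exact: is_derive1_comp fx' dt.
Qed.

Definition jointly_continuous (f : R -> V -> R) :=
  continuous (fun p : R * V => f p.1 p.2).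

Lemma jointly_continuousl (f : R -> V -> R) (x : V) :
  jointly_continuous f -> continuous (f ^~ x).
Proof.
move=> cf t; apply: (@continuous_comp _ _ _ (fun s : R => (s, x)) (fun p => f p.1 p.2)).
  exact: (cvg_pair cvg_id (cvg_cst x)).
exact: cf.
Qed.

Lemma jointly_continuousr (f : R -> V -> R) (t : R) :
  jointly_continuous f -> continuous (f t).
Proof.
move=> cf x; apply: (@continuous_comp _ _ _ (fun y : V => (t, y)) (fun p => f p.1 p.2)).
  exact: (cvg_pair (cvg_cst t) cvg_id).
exact: cf.
Qed.

(** Tube lemma: compactness of [-T, T] makes the neighbourhood of x0 uniform in t. *)
Lemma jointly_continuous_near (f : R -> V -> R) (T e : R) (x0 : V) :
  jointly_continuous f -> 0 < e ->
  \forall x \near x0, forall t : R, `|t| <= T -> `|f t x - f t x0| <= e.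
Proof.
move=> cf e0; have e2 : 0 < e / 2 by rewrite divr_gt0.
have /compact_near_coveringP/near_covering_withinP cT := @segment_compact R (- T) T.
have : \forall x \near x0, `[- T, T] `<=` [set t | `|f t x - f t x0| <= e].
  apply: cT => t _.
  have /cvgrPdist_lt /(_ _ e2) := cf (t, x0).
  move=> [[A C] /= [At Cx] AC].
  exists (A, C) => //= -[s x] /= [As Cx'] _.
  have H1 := AC (s, x) (conj As Cx').
  have H2 := AC (s, x0) (conj As (nbhs_singleton Cx)).
  rewrite /= in H1 H2.
  have -> : f s x - f s x0 = (f t x0 - f s x0) - (f t x0 - f s x) by ring.
  by apply: (le_trans (ler_normB _ _)); lra.
apply: filterS => x H t tT; apply: H; rewrite /= in_itv /=.
by rewrite -ler_norml.
Qed.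

Lemma jointly_continuousP (f : R -> V -> R) :
  (forall x, continuous (f ^~ x)) ->
  (forall (T e : R) x0, 0 < e ->
    \forall x \near x0, forall t : R, `|t| <= T -> `|f t x - f t x0| <= e) ->
  jointly_continuous f.
Proof.
move=> ct cx [t0 x0]; apply/cvgrPdist_le => e e0 /=.
have e2 : 0 < e / 2 by rewrite divr_gt0.
have H1 := cx (`|t0| + 1) _ x0 e2.
have /cvgrPdist_le /(_ _ e2) H2 := ct x0 t0.
have H3 : \forall t \near t0, `|t0 - t| < 1.
  exact: (@cvgr_dist_lt _ _ _ _ (nbhs_filter t0) id t0 cvg_id 1 ltr01).
exists ([set t | `|f t0 x0 - f t x0| <= e / 2] `&` [set t | `|t0 - t| < 1],
  [set x | forall t : R, `|t| <= `|t0| + 1 -> `|f t x - f t x0| <= e / 2]) => /=.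
  by split => //; exact: filterI.
move=> [t x] /= [[A1 A2] A3].
have tT : `|t| <= `|t0| + 1 by have := ler_normB t0 (t0 - t); rewrite subKr; lra.
have {}A3 := A3 _ tT.
have -> : f t0 x0 - f t x = (f t0 x0 - f t x0) - (f t x - f t x0) by ring.
by apply: (le_trans (ler_normB _ _)); lra.
Qed.

Lemma cvg_line (v x : V) : (fun h : R => h *: v + x) @ (0 : R) --> x.
Proof.
rewrite -[X in _ --> X]add0r -(scale0r v); apply: cvgD; last exact: cvg_cst.
by apply: cvgZr_tmp; exact: cvg_id.
Qed.

(** The mean value inequality is applied to f(s v + x0) - f'(x0) s; uniformity in t is inherited
    from [f'] by the tube lemma. *)
Lemma difference_quotient_near (f f' : R -> V -> R) (v x0 : V) (T e : R) :
  (forall t x, is_derive x v (f t) (f' t x)) -> jointly_continuous f' -> 0 < e ->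
  \forall h \near 0^', forall t : R, `|t| <= T ->
    `|h^-1 * (f t (h *: v + x0) - f t x0) - f' t x0| <= e.
Proof.
move=> df cf' e0.
have /(cvg_line v) := jointly_continuous_near T x0 cf' e0.
move=> [r /= r0 Hr]; near=> h => t tT.
have h0 : h != 0 by near: h; exact: nbhs_dnbhs_neq.
have hr : `|h| < r by near: h; exact: dnbhs0_lt.
have := @norm_increment_le_sym R (fun s => f t (s *: v + x0) - f' t x0 * s)
  (fun s => f' t (s *: v + x0) - f' t x0) (fun s => e * s) (fun _ => e) `|h|.
move=> /(_ _ _ _ h (lexx _)); rewrite scale0r add0r !mulr0 !subr0 => H.
have {}H : `|f t (h *: v + x0) - f' t x0 * h - f t x0| <= e * `|h|.
  apply: H => [s sh|s|s sh].
  - have d1 : is_derive s 1 (fun s : R => f t (s *: v + x0)) (f' t (s *: v + x0)).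
      exact/is_derive_line.
    exact: is_derive_subr d1 (is_derive_linear (f' t x0) s).
  - exact: is_derive_linear.
  - by apply: Hr => //=; rewrite sub0r normrN (le_lt_trans sh).
have h0' : 0 < `|h| by rewrite normr_gt0.
rewrite -(ler_pM2r h0') -normrM.
have -> // : (h^-1 * (f t (h *: v + x0) - f t x0) - f' t x0) * h =
  f t (h *: v + x0) - f' t x0 * h - f t x0.
by rewrite mulrBl mulrAC mulVf// mul1r; ring.
Unshelve. all: by end_near. Qed.

End Lines.

(** * Differentiability in the parameter *)

Section ParametricSystem.
Context {R : realType} {V : normedModType R} {J : finType}.
Variables (B : J -> J -> R -> V -> R) (y : J -> R -> V -> R) (c : J -> R).
Hypothesis cB : forall j k, jointly_continuous (B j k).
Hypothesis y0 : forall j x, y j 0 x = c j.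
Hypothesis dy : forall x,
  linear_solution (fun j k => B j k ^~ x) (fun j => y j ^~ x).

Lemma continuous_family_bounded (z : J -> R -> R) (T : R) :
  (forall j, continuous (z j)) ->
  exists Z, 0 <= Z /\ forall j (t : R), `|t| <= T -> `|z j t| <= Z.
Proof.
move=> cz.
have [Z [Z0 HZ]] := @continuous_matrix_bounded R J (fun j _ => z j) T (fun j _ => cz j).
by exists Z; split => // j t tT; exact: HZ.
Qed.

Lemma param_coef_near (T e : R) (x0 : V) : 0 < e ->
  \forall x \near x0, forall j k (t : R), `|t| <= T -> `|B j k t x - B j k t x0| <= e.
Proof.
move=> e0.
have H : forall jk : J * J, \forall x \near x0, forall t : R, `|t| <= T ->
    `|B jk.1 jk.2 t x - B jk.1 jk.2 t x0| <= e.
  by move=> jk; exact: (jointly_continuous_near T x0 (@cB jk.1 jk.2) e0).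
near=> x => j k.
have HH : forall jk : J * J, forall t : R, `|t| <= T ->
    `|B jk.1 jk.2 t x - B jk.1 jk.2 t x0| <= e by near: x; exact: filter_forall.
exact: (HH (j, k)).
Unshelve. all: by end_near.
Qed.

Lemma param_solution_time_continuous j x : continuous (fun t => y j t x).
Proof. by move=> t; exact: is_derive_continuous (dy x j t). Qed.

(** The difference w = y(x) - y(x0) solves w' = B(x) w + (B(x) - B(x0)) y(x0), with a forcing term
    that is small near x0. *)
Lemma param_solution_continuous j : jointly_continuous (y j).
Proof.
apply: jointly_continuousP => [x|T e x0 e0]; first exact: param_solution_time_continuous.
have [M [M0 BM]] := @continuous_matrix_bounded R J (fun j k => B j k ^~ x0) T
  (fun j k => @jointly_continuousl R V (B j k) x0 (@cB j k)).
have [Y [Y0 YB]] := @continuous_family_bounded (fun k => y k ^~ x0) T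
  (fun k => @param_solution_time_continuous k x0).
have n0 : 0 <= #|J|%:R :> R by rewrite ler0n.
pose G := @gronwall_bound R J (M + 1) T.
have G0 : 0 <= G by exact: sqrtr_ge0.
(* The bound 1 keeps the coefficients at x below M + 1; the quotient makes the Gronwall bound at
   most e, its added 1 keeping the denominator positive. *)
pose eta := Num.min 1 (e / (#|J|%:R * Y * G + 1)).
have D0 : 0 < #|J|%:R * Y * G + 1 by rewrite ltr_wpDl// !mulr_ge0.
have eta0 : 0 < eta by rewrite lt_min ltr01 divr_gt0.
have etae : #|J|%:R * (eta * Y) * G <= e.
  have : eta * (#|J|%:R * Y * G + 1) <= e by rewrite -ler_pdivlMr// ge_min lexx orbT.
  by nra.
have near_x0 := param_coef_near T x0 eta0.
near=> x => t tT.
have Bx : forall j k (t : R), `|t| <= T -> `|B j k t x - B j k t x0| <= eta by near: x.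
apply: le_trans etae.
apply: (@gronwall R J (M + 1) T (#|J|%:R * (eta * Y)) (fun j s => y j s x - y j s x0)
  (fun j s => \sum_k B j k s x * y k s x - \sum_k B j k s x0 * y k s x0)) => //.
- by rewrite addr_ge0.
- by rewrite !mulr_ge0// ltW.
- by move=> i; rewrite !y0 subrr.
- by move=> i s _; exact: is_derive_subr (dy x i s) (dy x0 i s).
move=> i s sT.
have -> : \sum_k B i k s x * y k s x - \sum_k B i k s x0 * y k s x0 =
  \sum_k B i k s x * (y k s x - y k s x0) + \sum_k (B i k s x - B i k s x0) * y k s x0.
  by rewrite -sumrB -big_split /=; apply: eq_bigr => k _; ring.
apply: (le_trans (ler_normD _ _)); apply: lerD.
  rewrite mulr_sumr; apply: (le_trans (ler_norm_sum _ _ _)); apply: ler_sum => k _.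
  rewrite normrM ler_wpM2r//.
  have := BM i k s sT; have := Bx i k s sT.
  have := ler_normD (B i k s x - B i k s x0) (B i k s x0); rewrite subrK.
  have : eta <= 1 by rewrite ge_min lexx.
  by move=> *; lra.
apply: (@linear_rhs_le R J (fun i k s => B i k s x - B i k s x0) (fun k => y k s x0)) => //.
- exact: ltW.
- by move=> i' k; exact: Bx.
- by move=> k; exact: YB.
Unshelve. all: by end_near. Qed.

Variables (v : V) (B' : J -> J -> R -> V -> R) (z : J -> R -> V -> R).
Hypothesis dB : forall j k t x, is_derive x v (B j k t) (B' j k t x).
Hypothesis cB' : forall j k, jointly_continuous (B' j k).
Hypothesis z0 : forall j x, z j 0 x = 0.
Hypothesis dz : forall x j (t : R), is_derive t 1 (fun t => z j t x)
  (\sum_k B' j k t x * y k t x + \sum_k B j k t x * z k t x).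

(** Let w be the difference quotient of y minus z at x0. Then w' = B(x) w + (B(x) - B(x0)) z + (q -
    B') y(x0), where q is the difference quotient of B; both forcing terms tend to 0 with h,
    uniformly on bounded times. *)
Lemma param_solution_derive j t x : is_derive x v (y j t) (z j t x).
Proof.
suff H : (fun h => h^-1 *: ((y j t \o shift x) (h *: v) - y j t x)) @ 0^' --> z j t x.
  by split; [apply/cvg_ex; eexists; exact: H|exact/cvg_lim].
apply/cvgrPdist_le => e e0.
pose T := `|t|; rename x into x0.
have [M [M0 BM]] := @continuous_matrix_bounded R J (fun j k => B j k ^~ x0) T
  (fun j k => @jointly_continuousl R V (B j k) x0 (@cB j k)).
have [Y [Y0 YB]] := @continuous_family_bounded (fun k => y k ^~ x0) T
  (fun k => @param_solution_time_continuous k x0).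
have [Z [Z0 ZB]] := @continuous_family_bounded (fun k => z k ^~ x0) T
  (fun k s => is_derive_continuous (dz x0 k s)).
have n0 : 0 <= #|J|%:R :> R by rewrite ler0n.
pose G := @gronwall_bound R J (M + 1) T.
have G0 : 0 <= G by exact: sqrtr_ge0.
pose eta := Num.min 1 (e / (#|J|%:R * (Z + Y) * G + 1)).
have D0 : 0 < #|J|%:R * (Z + Y) * G + 1 by rewrite ltr_wpDl// !mulr_ge0// addr_ge0.
have eta0 : 0 < eta by rewrite lt_min ltr01 divr_gt0.
have etae : (#|J|%:R * (eta * Z) + #|J|%:R * (eta * Y)) * G <= e.
  have : eta * (#|J|%:R * (Z + Y) * G + 1) <= e by rewrite -ler_pdivlMr// ge_min lexx orbT.
  by nra.
have cl : (fun h : R => h *: v + x0) @ (0 : R)^' --> x0.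
  by apply: cvg_within_filter; exact: cvg_line.
have /cl near_x0 := param_coef_near T x0 eta0.
have near_q : \forall h \near 0^', forall jk : J * J, forall s : R, `|s| <= T ->
    `|h^-1 * (B jk.1 jk.2 s (h *: v + x0) - B jk.1 jk.2 s x0) - B' jk.1 jk.2 s x0| <= eta.
  apply: filter_forall => jk.
  exact: (difference_quotient_near x0 T (dB jk.1 jk.2) (@cB' jk.1 jk.2) eta0).
near=> h.
have h0 : h != 0 by near: h; exact: nbhs_dnbhs_neq.
have Bx : forall j k (t : R), `|t| <= T -> 
    `|B j k t (h *: v + x0) - B j k t x0| <= eta by near: h.
have Bq : forall jk : J * J, forall s : R, `|s| <= T ->
    `|h^-1 * (B jk.1 jk.2 s (h *: v + x0) - B jk.1 jk.2 s x0) - B' jk.1 jk.2 s x0| <= eta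
  by near: h.
set x := h *: v + x0 in Bx Bq.
rewrite distrC /= -/x; apply: le_trans etae.
apply: (@gronwall R J (M + 1) T (#|J|%:R * (eta * Z) + #|J|%:R * (eta * Y))
  (fun j s => h^-1 * (y j s x - y j s x0) - z j s x0)
  (fun j s => h^-1 * (\sum_k B j k s x * y k s x - \sum_k B j k s x0 * y k s x0)
   - (\sum_k B' j k s x0 * y k s x0 + \sum_k B j k s x0 * z k s x0))) => //.
- by rewrite addr_ge0.
- by rewrite addr_ge0// !mulr_ge0// ltW.
- by move=> i; rewrite !y0 z0 subrr mulr0 subrr.
- move=> i s _; apply: is_derive_subr (dz x0 i s).
  exact: (is_derive_cmul h^-1 (is_derive_subr (dy x i s) (dy x0 i s))).
move=> i s sT.
have -> : h^-1 * (\sum_k B i k s x * y k s x - \sum_k B i k s x0 * y k s x0)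
   - (\sum_k B' i k s x0 * y k s x0 + \sum_k B i k s x0 * z k s x0) =
  \sum_k B i k s x * (h^-1 * (y k s x - y k s x0) - z k s x0) +
  (\sum_k (B i k s x - B i k s x0) * z k s x0 +
   \sum_k (h^-1 * (B i k s x - B i k s x0) - B' i k s x0) * y k s x0).
  rewrite -sumrB mulr_sumr -!big_split -sumrB /=; apply: eq_bigr => k _; ring.
apply: (le_trans (ler_normD _ _)); apply: lerD.
  rewrite mulr_sumr; apply: (le_trans (ler_norm_sum _ _ _)); apply: ler_sum => k _.
  rewrite normrM ler_wpM2r//.
  have := BM i k s sT; have := Bx i k s sT.
  have := ler_normD (B i k s x - B i k s x0) (B i k s x0); rewrite subrK.
  have : eta <= 1 by rewrite ge_min lexx.
  by move=> *; lra.
apply: (le_trans (ler_normD _ _)); apply: lerD.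
  apply: (@linear_rhs_le R J (fun i k s => B i k s x - B i k s x0) (fun k => z k s x0)) => //.
  - exact: ltW.
  - by move=> i' k; exact: Bx.
  - by move=> k; exact: ZB.
apply: (@linear_rhs_le R J (fun i k s => h^-1 * (B i k s x - B i k s x0) - B' i k s x0)
   (fun k => y k s x0)) => //.
- exact: ltW.
- by move=> i' k; exact: (Bq (i', k)).
- by move=> k; exact: YB.
Unshelve. all: by end_near. Qed.

End ParametricSystem.

(** * Smooth families and smooth dependence *)

Section Families.
Context {R : realType} {d : nat}.
Local Notation V := 'rV[R]_d.
Implicit Types (f g : R -> V -> R).

(** Only derivatives in x are counted, each jointly continuous in (t, x). They are given
    existentially so that closure proofs can supply them by formula. *)
Fixpoint Ck_family (k : nat) f : Prop :=
  jointly_continuous f /\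
  if k is k'.+1 then
    forall i, exists f', (forall t x, is_derive x (basisv R i) (f t) (f' t x)) /\
      Ck_family k' f'
  else True.

Lemma Ck_family_continuous k f : Ck_family k f -> jointly_continuous f.
Proof. by case: k => [|k] []. Qed.

Lemma Ck_familyW k f : Ck_family k.+1 f -> Ck_family k f.
Proof.
elim: k f => [|k IHk] f [cf df]; first by split.
split => // i; have [f' [ff' /IHk ?]] := df i.
by exists f'.
Qed.

Lemma Ck_family_at k f t : Ck_family k f -> Ck k (f t).
Proof.
elim: k f => [|k IHk] f [cf df] /=; first exact: jointly_continuousr.
split; first exact: jointly_continuousr.
  move=> x i; have [f' [ff' _]] := df i.
  exact: (@ex_derive _ _ _ _ _ _ _ (ff' t x)).
move=> i; have [f' [ff' /IHk]] := df i.
suff -> : 'D_(basisv R i) (f t) = f' t by [].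
by apply/funext => x; exact: (@derive_val _ _ _ _ _ _ _ (ff' t x)).
Qed.

Lemma Ck_family_scaled k (f : V -> R) : Ck k f ->
  Ck_family k (fun t x => f (t *: x)).
Proof.
(* Each derivative of f(t x) in x produces a factor t, so the induction must carry powers of t. *)
suff H : forall k (f : V -> R) n, Ck k f -> Ck_family k (fun t x => t ^+ n * f (t *: x)).
  move=> fk; have := H k f 0%N fk.
  by under [in X in X -> _]eq_fun do under eq_fun do rewrite expr0 mul1r.
move=> {}k {}f n.
have cF (g : V -> R) m : continuous g -> jointly_continuous (fun t x => t ^+ m * g (t *: x)).
  move=> cg [t x] /=; apply: cvgM.
    apply: (@continuous_comp _ _ _ (fun p : R * V => p.1) (fun t : R => t ^+ m)).
      exact: cvg_fst.
    exact: exprn_continuous.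
  apply: (@continuous_comp _ _ _ (fun p : R * V => p.1 *: p.2) g); last exact: cg.
  exact: scale_continuous.
elim: k f n => [|k IHk] f n /=; first by move=> cf; split => //; exact: cF.
move=> [cf df dfk]; split; first exact: cF.
move=> i; exists (fun t x => t ^+ n.+1 * 'D_(basisv R i) f (t *: x)).
split; last exact: (IHk _ n.+1 (dfk i)).
move=> t x.
have fx := is_derive_scaled (derivableP (df (t *: x) i)).
apply: (is_derive_eq (is_derive_cmul (t ^+ n) fx)).
by rewrite exprSr mulrA.
Qed.

(** Together with [Ck_family_at] this transfers the closure properties of families to smooth
    functions. *)
Lemma Ck_family_const k (f : V -> R) : Ck k f -> Ck_family k (fun _ => f).
Proof.
have cF (g : V -> R) : continuous g -> jointly_continuous (fun _ : R => g).
  move=> cg [t x]; apply: (@continuous_comp _ _ _ (fun p : R * V => p.2) g); last exact: cg.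
  exact: cvg_snd.
elim: k f => [|k IHk] f /=; first by move=> cf; split => //; exact: cF.
move=> [cf df dfk]; split; first exact: cF.
move=> i; exists (fun _ => 'D_(basisv R i) f); split; last exact: (IHk _ (dfk i)).
by move=> _ x; apply: derivableP; exact: df.
Qed.

Lemma Ck_family_cst k (c : R) : Ck_family k (fun _ _ => c).
Proof.
elim: k c => [|k IHk] c; first by split => // ?; exact: cvg_cst.
split=> [?|i]; first exact: cvg_cst.
by exists (fun _ _ => 0); split => // t x; exact: is_derive_cst.
Qed.

Lemma Ck_familyD k f g : Ck_family k f -> Ck_family k g ->
  Ck_family k (fun t x => f t x + g t x).
Proof.
have cD f1 g1 : jointly_continuous f1 -> jointly_continuous g1 ->
    jointly_continuous (fun t x => f1 t x + g1 t x).
  by move=> cf cg p; apply: cvgD; [exact: cf|exact: cg].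
elim: k f g => [|k IHk] f g [cf df] [cg dg]; split; try by [|exact: cD].
move=> i; have [f' [ff' f'k]] := df i; have [g' [gg' g'k]] := dg i.
exists (fun t x => f' t x + g' t x); split; last exact: IHk.
by move=> t x; apply: is_derive_addr.
Qed.

Lemma Ck_familyM k f g : Ck_family k f -> Ck_family k g ->
  Ck_family k (fun t x => f t x * g t x).
Proof.
have cM f1 g1 : jointly_continuous f1 -> jointly_continuous g1 ->
    jointly_continuous (fun t x => f1 t x * g1 t x).
  by move=> cf cg p; apply: cvgM; [exact: cf|exact: cg].
elim: k f g => [|k IHk] f g fk gk; have [cf df] := fk; have [cg dg] := gk;
  split; try by [|exact: cM].
move=> i; have [f' [ff' f'k]] := df i; have [g' [gg' g'k]] := dg i.
exists (fun t x => f' t x * g t x + f t x * g' t x); split.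
  by move=> t x; apply: is_derive_mulr.
by apply: Ck_familyD; apply: IHk => //; exact: Ck_familyW.
Qed.

Lemma Ck_family_sum k (I : Type) (r : seq I) (F : I -> R -> V -> R) :
  (forall i, Ck_family k (F i)) -> Ck_family k (fun t x => \sum_(i <- r) F i t x).
Proof.
move=> Fk; elim: r => [|i r IHr].
  by under [X in Ck_family _ X]eq_fun do under eq_fun do rewrite big_nil; exact: Ck_family_cst.
under [X in Ck_family _ X]eq_fun do under eq_fun do rewrite big_cons.
exact: Ck_familyD.
Qed.

Lemma Ck_family_prod k (I : Type) (r : seq I) (F : I -> R -> V -> R) :
  (forall i, Ck_family k (F i)) -> Ck_family k (fun t x => \prod_(i <- r) F i t x).
Proof.
move=> Fk; elim: r => [|i r IHr].
  by under [X in Ck_family _ X]eq_fun do under eq_fun do rewrite big_nil; exact: Ck_family_cst.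
under [X in Ck_family _ X]eq_fun do under eq_fun do rewrite big_cons.
exact: Ck_familyM.
Qed.

Lemma Ck_familyV k f : (forall t x, f t x != 0) -> Ck_family k f ->
  Ck_family k (fun t x => (f t x)^-1).
Proof.
have cV f1 : (forall t x, f1 t x != 0) -> jointly_continuous f1 ->
    jointly_continuous (fun t x => (f1 t x)^-1).
  by move=> f10 cf [t x]; apply: cvgV; [exact: f10|exact: cf].
elim: k f => [|k IHk] f f0 fk; have [cf df] := fk; split; try by [|exact: cV].
move=> i; have [f' [ff' f'k]] := df i.
exists (fun t x => -1 * ((f t x)^-1 * (f t x)^-1) * f' t x); split.
  move=> t x; have [d1 d2] := ff' t x; split; first exact: derivableV.
  by rewrite deriveV// d2 mulN1r -expr2 exprVn.
have Vk := IHk _ f0 (Ck_familyW fk).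
by apply: Ck_familyM => //; apply: Ck_familyM; [exact: Ck_family_cst|exact: Ck_familyM].
Qed.

Lemma Ck_family_coord k i : Ck_family k (fun _ x => Defs.coord x i).
Proof.
have cc : jointly_continuous (fun (_ : R) (x : V) => Defs.coord x i).
  move=> [t x].
  apply: (@continuous_comp _ _ _ (fun p : R * V => p.2) (fun x => Defs.coord x i)).
    exact: cvg_snd.
  exact: coord_continuous.
case: k => [|k]; split => // j.
exists (fun _ _ => (i == j)%:R); split; last exact: Ck_family_cst.
move=> _ x; rewrite -[x]add0r -(scale0r (basisv R j)); apply/is_derive_line.
have -> : (fun h : R => Defs.coord (h *: basisv R j + x) i) =
    (fun h => (i == j)%:R * h + Defs.coord x i).
  by apply/funext => h; rewrite /Defs.coord /basisv !mxE eqxx /= mulrC.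
apply: (is_derive_eq (is_derive_addr (is_derive_linear _ (0 : R))
  (is_derive_cst _ (0 : R) 1))).
by rewrite addr0.
Qed.

End Families.

(* Differentiating y' = B y in a parameter direction shows that y and its
   derivative z solve y' = B y, z' = (d B) y + B z, which is again a linear
   system, with one derivative less: this drives the induction on k. *)
Theorem Ck_family_solution (R : realType) (d k : nat) (J : finType)
    (B : J -> J -> R -> 'rV[R]_d -> R) (y : J -> R -> 'rV[R]_d -> R) (c : J -> R) :
  (forall i j, Ck_family k (B i j)) -> (forall j x, y j 0 x = c j) ->
  (forall x, linear_solution (fun i j => B i j ^~ x) (fun j => y j ^~ x)) ->
  forall j, Ck_family k (y j).
Proof.
elim: k J B y c => [|k IHk] J B y c Bk y0 dy j.
all: have cB i l : jointly_continuous (B i l) by exact: Ck_family_continuous (Bk i l).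
all: split; first exact: (param_solution_continuous cB y0 dy).
  by [].
move=> e.
have /choice [B1 HB1] : forall il : J * J, exists f' : R -> 'rV[R]_d -> R,
    (forall t x, is_derive x (basisv R e) (B il.1 il.2 t) (f' t x)) /\ Ck_family k f'.
  by move=> [i l]; have [_] := Bk i l; exact.
pose BB (a b : J + J) : R -> 'rV[R]_d -> R := match a, b with
  | inl i, inl l => B i l
  | inl _, inr _ => fun _ _ => 0
  | inr i, inl l => B1 (i, l)
  | inr i, inr l => B i l end.
have BBk a b : Ck_family k (BB a b).
  case: a => i; case: b => l /=; try exact: Ck_familyW.
    exact: Ck_family_cst.
  exact: (HB1 (i, l)).2.
(* The second block starts at 0 because the initial value c does not depend on x. *)
pose cc (a : J + J) : R := if a is inl i then c i else 0.
have /choice [Y HY] : forall x, exists Y : J + J -> R -> R,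
    (forall a, Y a 0 = cc a) /\ linear_solution (fun a b => BB a b ^~ x) Y.
  move=> x; apply: linear_solution_exists => a b.
  exact/jointly_continuousl/(Ck_family_continuous (BBk a b)).
have dY x : linear_solution (fun i l => B i l ^~ x) (fun i => Y x (inl i)).
  move=> i t; have := (HY x).2 (inl i) t; rewrite big_sumType /=.
  by rewrite [X in _ + X]big1 ?addr0// => l _; rewrite mul0r.
(* The first block solves the original system, so uniqueness identifies it with y. *)
have Yy x i : Y x (inl i) = y i ^~ x.
  have := @linear_solution_unique R J _ _ _ _ (dY x) (dy x) _.
  move=> /(_ (fun i l => jointly_continuousl (cB i l))) H.
  have := H (fun i => _); move=> /(_ _)/(congr1 (fun h => h i)) /=; apply.
  by move=> l; rewrite (HY x).1 y0.
exists (fun t x => Y x (inr j) t); split; last first.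
  exact: (IHk _ BB (fun a t x => Y x a t) cc BBk (fun a x => (HY x).1 a) (fun x => (HY x).2)).
move=> t x.
apply: (@param_solution_derive R _ J B y c cB y0 dy (basisv R e)
  (fun i l => B1 (i, l)) (fun i t x => Y x (inr i) t)).
- by move=> i l s z; exact: (HB1 (i, l)).1.
- by move=> i l; exact: Ck_family_continuous (HB1 (i, l)).2.
- by move=> i z; rewrite (HY z).1.
- move=> z i s; have := (HY z).2 (inr i) s; rewrite big_sumType /=.
  by under eq_bigr do rewrite Yy.
Qed.

(** * Smooth functions on R^d *)

Section SmoothFunctions.
Context {R : realType} {d : nat}.
Local Notation V := 'rV[R]_d.
Implicit Types (f g : V -> R).

Lemma smooth_cst (c : R) : smooth (fun _ : V => c).
Proof. by move=> k; exact: (Ck_family_at 0 (Ck_family_cst k c)). Qed.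

Lemma smoothM f g : smooth f -> smooth g -> smooth (fun x => f x * g x).
Proof.
move=> sf sg k.
exact: (Ck_family_at 0 (Ck_familyM (Ck_family_const (sf k)) (Ck_family_const (sg k)))).
Qed.

Lemma smooth_sum (I : Type) (r : seq I) (F : I -> V -> R) :
  (forall i, smooth (F i)) -> smooth (fun x => \sum_(i <- r) F i x).
Proof.
move=> sF k.
exact: (Ck_family_at 0 (Ck_family_sum r (fun i => Ck_family_const (sF i k)))).
Qed.

Lemma smooth_prod (I : Type) (r : seq I) (F : I -> V -> R) :
  (forall i, smooth (F i)) -> smooth (fun x => \prod_(i <- r) F i x).
Proof.
move=> sF k.
exact: (Ck_family_at 0 (Ck_family_prod r (fun i => Ck_family_const (sF i k)))).
Qed.

Lemma smoothV f : (forall x, f x != 0) -> smooth f -> smooth (fun x => (f x)^-1).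
Proof.
move=> f0 sf k.
exact: (Ck_family_at 0 (Ck_familyV (fun _ => f0) (Ck_family_const (sf k)))).
Qed.

Lemma smooth_continuous f : smooth f -> continuous f.
Proof. by move=> sf; exact: (sf 0%N). Qed.

Lemma smooth_partial f i : smooth f -> smooth ('D_(basisv R i) f).
Proof. by move=> sf k; have [_ _] := sf k.+1; exact. Qed.

Lemma smooth_det n (M : V -> 'M[R]_n) :
  (forall i j, smooth (fun x => M x i j)) -> smooth (fun x => \det (M x)).
Proof.
move=> sM; rewrite /determinant.
by apply: smooth_sum => s; apply: smoothM; [exact: smooth_cst|apply: smooth_prod].
Qed.

Lemma smooth_invmx n (M : V -> 'M[R]_n) : (forall x, M x \in unitmx) ->
  (forall i j, smooth (fun x => M x i j)) ->
  forall i j, smooth (fun x => invmx (M x) i j).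
Proof.
move=> uM sM i j.
have -> : (fun x => invmx (M x) i j) = fun x => (\det (M x))^-1 *
    ((-1) ^+ (j + i) * \det (row' j (col' i (M x)))).
  by apply/funext => x; rewrite /invmx uM !mxE.
apply: smoothM.
  apply: smoothV; last exact: smooth_det.
  by move=> x; have := uM x; rewrite unitmxE unitfE.
apply: smoothM; first exact: smooth_cst.
apply: smooth_det => k l.
by under eq_fun do rewrite !mxE; exact: sM.
Qed.

(** By induction on the basis vectors: the increment is split into one along v and one along a
    single basis vector, and the latter is controlled by the mean value inequality and continuity of
    that partial derivative. *)
Lemma is_derive_span f (f' : 'I_d -> V -> R) (c : 'I_d -> R) (r : seq 'I_d) x :
  (forall i x, is_derive x (basisv R i) f (f' i x)) ->
  (forall i, continuous (f' i)) ->
  is_derive x (\sum_(i <- r) c i *: basisv R i) f (\sum_(i <- r) c i * f' i x).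
Proof.
move=> df cf'; elim: r => [|i r IHr]; first by rewrite !big_nil; exact: is_derive0.
rewrite !big_cons; set v := \sum_(_ <- _) _ in IHr *; set a := \sum_(_ <- _) _ in IHr *.
suff H : (fun h => h^-1 *: (f (h *: (c i *: basisv R i + v) + x) - f x)) @ (0 : R)^'
    --> c i * f' i x + a.
  by split; [apply/cvg_ex; eexists; exact: H|exact/cvg_lim].
have H2 : (fun h => h^-1 *: (f (h *: v + x) - f x)) @ (0 : R)^' --> a.
  by have [d1 <-] := IHr.
have -> : (fun h => h^-1 *: (f (h *: (c i *: basisv R i + v) + x) - f x)) =
    (fun h => h^-1 *: (f ((h * c i) *: basisv R i + (h *: v + x)) - f (h *: v + x))
      + h^-1 *: (f (h *: v + x) - f x)).
  by apply/funext => h; rewrite [h *: _]scalerDr scalerA -addrA -scalerDr subrKA.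
apply: cvgD H2; apply/cvgrPdist_le => e e0.
(* If |h| K < q, the whole path from x through h v + x stays in the ball of radius q. Dividing e by
   |c i| + 1 compensates the step length |h c i|. *)
pose K := `|c i| * `|basisv R i| + `|v| + 1.
have K0 : 0 < K by rewrite ltr_wpDl// addr_ge0// mulr_ge0.
have c0 : 0 < `|c i| + 1 by rewrite ltr_wpDl.
have e1 : 0 < e / (`|c i| + 1) by rewrite divr_gt0.
have /cvgrPdist_le /(_ _ e1) /nbhs_ballP [q /= q0 Hq] := cf' i x.
near=> h.
have h0 : h != 0 by near: h; exact: nbhs_dnbhs_neq.
have hq : `|h| < q / K by near: h; apply: dnbhs0_lt; rewrite divr_gt0.
set z := h *: v + x.
have := @norm_increment_le_sym R (fun s => f (s *: basisv R i + z) - f' i x * s)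
  (fun s => f' i (s *: basisv R i + z) - f' i x) (fun s => e / (`|c i| + 1) * s)
  (fun _ => e / (`|c i| + 1)) `|h * c i|.
move=> /(_ _ _ _ (h * c i) (lexx _)); rewrite scale0r add0r !mulr0 !subr0 => H.
have {}H : `|f ((h * c i) *: basisv R i + z) - f' i x * (h * c i) - f z|
    <= e / (`|c i| + 1) * `|h * c i|.
  apply: H => [s sh|s|s sh].
  - have d1 : is_derive s 1 (fun s : R => f (s *: basisv R i + z))
        (f' i (s *: basisv R i + z)).
      exact/is_derive_line.
    exact: is_derive_subr d1 (is_derive_linear (f' i x) s).
  - exact: is_derive_linear.
  - rewrite distrC; apply: Hq; rewrite -ball_normE /= /z.
    rewrite addrA opprD addrA addrAC subrr add0r normrN.
    apply: (le_lt_trans (ler_normD _ _)); rewrite !normrZ.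
    have s1 : `|s| * `|basisv R i| <= `|h| * `|c i| * `|basisv R i|.
      by rewrite ler_wpM2r// -normrM.
    have : `|h| * K < q by rewrite -ltr_pdivlMr.
    have hp : 0 < `|h| by rewrite normr_gt0.
    by rewrite /K; nra.
have h0' : 0 < `|h| by rewrite normr_gt0.
rewrite distrC -(ler_pM2r h0') -normrM.
have -> : (h^-1 *: (f ((h * c i) *: basisv R i + z) - f z) - c i * f' i x) * h =
    f ((h * c i) *: basisv R i + z) - f' i x * (h * c i) - f z.
  by rewrite [_ *: _]mulrC mulrBl divfK//; ring.
apply: (le_trans H); rewrite normrM [`|h| * _]mulrC mulrA ler_wpM2r//.
by rewrite mulrAC ler_pdivrMr// ler_wpM2l ?ltW// ltrDl.
Unshelve. all: by end_near. Qed.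

Lemma is_derive_smooth f x v : smooth f ->
  is_derive x v f (\sum_i Defs.coord v i * 'D_(basisv R i) f x).
Proof.
move=> sf; have [_ df _] := sf 1%N.
rewrite {1}(row_sum_delta v).
apply: (@is_derive_span f (fun i => 'D_(basisv R i) f) (Defs.coord v)) => [i y|i].
  exact/derivableP/df.
exact/smooth_continuous/smooth_partial.
Qed.

Lemma smooth_deriveE f x v : smooth f ->
  'D_v f x = \sum_i Defs.coord v i * 'D_(basisv R i) f x.
Proof. by move=> sf; have [] := is_derive_smooth x v sf. Qed.

Lemma is_derive_smooth_ray f x (t : R) : smooth f ->
  is_derive t 1 (fun s : R => f (s *: x)) ('D_x f (t *: x)).
Proof.
move=> sf; apply/is_derive_ray/derivableP.
by have [] := is_derive_smooth (t *: x) x sf.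
Qed.

Lemma continuous_ray f x : continuous f -> continuous (fun t : R => f (t *: x)).
Proof.
move=> cf t; apply: (@continuous_comp _ _ _ (fun t : R => t *: x) f); last exact: cf.
by apply: cvgZr_tmp; exact: cvg_id.
Qed.

Lemma continuous_derive_ray f x : smooth f -> continuous (fun t : R => 'D_x f (t *: x)).
Proof.
move=> sf t.
under [X in continuous_at _ X]eq_fun do rewrite (smooth_deriveE _ _ sf).
apply: cvg_sumr => i; apply: cvgM; first exact: cvg_cst.
exact: (continuous_ray (smooth_continuous (smooth_partial i sf))).
Qed.

(** This converts the radial derivative at t x into t times the derivative along the ray. *)
Lemma smooth_deriveZ f x y (t : R) : smooth f -> 'D_(t *: x) f y = t * 'D_x f y.
Proof.
move=> sf; rewrite !smooth_deriveE// mulr_sumr; apply: eq_bigr => i _.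
by rewrite /Defs.coord mxE mulrA.
Qed.

End SmoothFunctions.

Lemma continuous_eq_at0 (R : realType) (f g : R -> R) :
  continuous f -> continuous g -> (forall t, t != 0 -> f t = g t) -> f 0 = g 0.
Proof.
move=> cf cg fg; apply/eqP; rewrite -subr_eq0 -normr_le0; apply/ler_addgt0Pl => e e0.
rewrite addr0.
have /cvgrPdist_lt /(_ _ e0) H : (fun t => f t - g t) @ (0 : R) --> f 0 - g 0.
  by apply: cvgB; [exact: cf|exact: cg].
have [r /= r0 /(_ (r / 2))] := H.
have r2 : 0 < r / 2 by rewrite divr_gt0.
rewrite /= (fg _ (lt0r_neq0 r2)) subrr subr0 => Hr; apply/ltW/Hr.
by rewrite sub0r normrN gtr0_norm//; lra.
Qed.

(** * Entrywise derivatives of matrix-valued curves *)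

Section MatrixDerivative.
Context {R : realType}.

Definition mx_derive (m n : nat) (t : R) (M : R -> 'M[R]_(m, n)) (M' : 'M[R]_(m, n)) :=
  forall i j, is_derive t 1 (fun s => M s i j) (M' i j).

Lemma mx_derive_unique m n t (M : R -> 'M[R]_(m, n)) M1 M2 :
  mx_derive t M M1 -> mx_derive t M M2 -> M1 = M2.
Proof.
move=> d1 d2; apply/matrixP => i j.
by have [_ <-] := d1 i j; have [_ <-] := d2 i j.
Qed.

Lemma mx_derive_cst m n t (M : 'M[R]_(m, n)) : mx_derive t (fun _ => M) 0.
Proof. by move=> i j; rewrite mxE; exact: is_derive_cst. Qed.

Lemma mx_derive_mul m n p t (A : R -> 'M[R]_(m, n)) (C : R -> 'M[R]_(n, p)) A' C' :
  mx_derive t A A' -> mx_derive t C C' ->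
  mx_derive t (fun s => A s *m C s) (A' *m C t + A t *m C').
Proof.
move=> dA dC i j; rewrite !mxE -big_split /=; under eq_fun do rewrite mxE.
by apply: is_derive_sumr => k; exact: is_derive_mulr.
Qed.

Lemma mx_derive_tr m n t (A : R -> 'M[R]_(m, n)) A' :
  mx_derive t A A' -> mx_derive t (fun s => (A s)^T) A'^T.
Proof. by move=> dA i j; rewrite mxE; under eq_fun do rewrite mxE. Qed.

Lemma mx_derive_sub m n t (A C : R -> 'M[R]_(m, n)) A' C' :
  mx_derive t A A' -> mx_derive t C C' ->
  mx_derive t (fun s => A s - C s) (A' - C').
Proof.
move=> dA dC i j; rewrite !mxE; under eq_fun do rewrite !mxE.
exact: is_derive_subr.
Qed.

Lemma mx_derive0_cst m n (M : R -> 'M[R]_(m, n)) s t :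
  (forall r, mx_derive r M 0) -> M s = M t.
Proof.
move=> dM; apply/matrixP => i j.
by apply: (@is_derive_0_is_cst R (fun r => M r i j)) => r; have := dM r i j; rewrite mxE.
Qed.

End MatrixDerivative.

(** * Vielbeins and metrics *)

Section Fields.
Context {R : realType} {d : nat}.
Local Notation V := 'rV[R]_d.
Implicit Types (e g f : field2 R d) (x y v : V) (t : R).

Definition smooth_field f := forall i j, smooth (f i j).

(** Direction first, base point second: the ray derivative is at (x, t x), the radial derivative of
    [lie_r] at (x, x). *)
Definition derive_emx f x y : 'M[R]_d := \matrix_(i, j) 'D_x (f i j) y.

Lemma mx_derive_ray f x t : smooth_field f ->
  mx_derive t (fun s => emx f (s *: x)) (derive_emx f x (t *: x)).
Proof.
move=> sf i j; rewrite mxE; under eq_fun do rewrite mxE.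
exact: is_derive_smooth_ray.
Qed.

Lemma derive_emxZ f x y t : smooth_field f ->
  derive_emx f (t *: x) y = t *: derive_emx f x y.
Proof. by move=> sf; apply/matrixP => i j; rewrite !mxE smooth_deriveZ. Qed.

Lemma emx_metric_of e x : emx (metric_of e) x = (emx e x)^T *m emx e x.
Proof.
apply/matrixP => i j; rewrite !mxE; apply: eq_bigr => a _.
by rewrite !mxE.
Qed.

Lemma metric_ofP e g :
  metric_of e = g <-> forall x, (emx e x)^T *m emx e x = emx g x.
Proof.
split=> [<- x|H]; first by rewrite emx_metric_of.
apply/funext => i; apply/funext => j; apply/funext => x.
by have /matrixP /(_ i j) := H x; rewrite -emx_metric_of !mxE.
Qed.

Lemma smooth_metric_of e : smooth_field e -> smooth_field (metric_of e).
Proof. by move=> se i j; apply: smooth_sum => a; exact: smoothM. Qed.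

(** Points are row vectors: contracting the first index is left multiplication by x, contracting the
    second is right multiplication by x^T. *)
Lemma contract_leftP f :
  (forall x nu, \sum_mu Defs.coord x mu * f mu nu x = Defs.coord x nu) <->
  (forall x, x *m emx f x = x).
Proof.
split=> H x.
  apply/rowP => j; rewrite mxE -[RHS]H; apply: eq_bigr => i _.
  by rewrite mxE.
move=> j; have /rowP /(_ j) := H x; rewrite mxE => Hj; rewrite -[RHS]Hj.
by apply: eq_bigr => i _; rewrite mxE.
Qed.

Lemma contract_rightP f :
  (forall x a, \sum_mu Defs.coord x mu * f a mu x = Defs.coord x a) <->
  (forall x, emx f x *m x^T = x^T).
Proof.
split=> H x.
  apply/colP => j; rewrite mxE [RHS]mxE -[RHS]H; apply: eq_bigr => i _.
  by rewrite !mxE mulrC.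
move=> j; have /colP /(_ j) := H x; rewrite !mxE => Hj; rewrite -[RHS]Hj.
by apply: eq_bigr => i _; rewrite !mxE mulrC.
Qed.

(** For t != 0 the identity at t x is divided by t; t = 0 follows by continuity. *)
Lemma contract_ray f x t : smooth_field f ->
  (forall x, x *m emx f x = x) -> x *m emx f (t *: x) = x.
Proof.
move=> sf H.
have H1 s : s != 0 -> x *m emx f (s *: x) = x.
  by move=> s0; apply: (scalerI s0); rewrite scalemxAl H.
have [->|/H1 //] := eqVneq t 0.
apply/rowP => j.
have := @continuous_eq_at0 R (fun s => (x *m emx f (s *: x)) 0 j) (fun _ => x 0 j).
apply; last by move=> s s0; rewrite H1.
- move=> s; under [X in continuous_at _ X]eq_fun do rewrite mxE.
  apply: cvg_sumr => i; apply: cvgM; first exact: cvg_cst.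
  under eq_fun do rewrite mxE; rewrite mxE.
  exact: (continuous_ray (smooth_continuous (sf i j))).
- by move=> s; exact: cvg_cst.
Qed.

(** At time 0, the ray through the i-th basis vector gives the i-th row. *)
Lemma contract_origin f : smooth_field f ->
  (forall x, x *m emx f x = x) -> emx f 0 = 1%:M.
Proof.
move=> sf H; apply/row_matrixP => i; rewrite !rowE mulmx1.
by rewrite -[in emx f 0](scale0r (delta_mx 0 i)) contract_ray.
Qed.

Lemma quadratic_formE f x v :
  \sum_mu \sum_nu v ord0 mu * f mu nu x * v ord0 nu = (v *m emx f x *m v^T) 0 0.
Proof.
rewrite mxE exchange_big /=; apply: eq_bigr => j _.
rewrite !mxE mulr_suml; apply: eq_bigr => i _.
by rewrite !mxE.
Qed.

(** x e^T e = (e x^T)^T e = x e = x, and the quadratic form at v is the squared length of v e^T,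
    nonzero because e is invertible. *)
Lemma good_vielbein_normal e : good_vielbein e -> normal_metric (metric_of e).
Proof.
move=> [[se ue] /contract_rightP H1 /contract_leftP H2 _]; split; last first.
  apply/contract_leftP => x; rewrite emx_metric_of mulmxA.
  by rewrite -[X in X *m _ *m _]trmxK -trmx_mul H1 trmxK H2.
split; first exact: smooth_metric_of.
  by move=> i j x; apply: eq_bigr => a _; rewrite mulrC.
move=> x v v0; rewrite quadratic_formE emx_metric_of.
set w := v *m (emx e x)^T.
have -> : (v *m ((emx e x)^T *m emx e x) *m v^T) 0 0 = \sum_a w 0 a * w 0 a.
  rewrite mulmxA -/w -mulmxA -[emx e x *m v^T]trmxK trmx_mul trmxK -/w mxE.
  by apply: eq_bigr => a _; rewrite !mxE.
have w0 : w != 0.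
  apply: contra_neq v0 => wE.
  by rewrite -[v](mulmxK (_ : (emx e x)^T \in unitmx)) ?unitmx_tr// -/w wE mul0mx.
have [a wa] : exists a, w 0 a != 0.
  apply/existsP; apply: contra_neqT w0 => /existsPn wa.
  by apply/rowP => a; rewrite [RHS]mxE; apply/eqP; move: (wa a); rewrite negbK.
rewrite (bigD1 a)//= ltr_wpDr//; first by apply: sumr_ge0 => b _; rewrite -expr2 sqr_ge0.
by rewrite -expr2 exprn_even_gt0.
Qed.

(** * Metrics in normal coordinates and the radial equation *)

Section NormalMetric.
Variable g : field2 R d.
Hypothesis ng : normal_metric g.

Lemma normal_smooth : smooth_field g. Proof. by case: ng => -[]. Qed.

Lemma normal_sym x : (emx g x)^T = emx g x.
Proof. by case: ng => -[_ gs _] _; apply/matrixP => i j; rewrite !mxE. Qed.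

Lemma normal_derive_sym x y : (derive_emx g x y)^T = derive_emx g x y.
Proof.
case: ng => -[_ gs _] _; apply/matrixP => i j; rewrite !mxE.
by congr ('D_x _ y); apply/funext => z.
Qed.

Lemma normal_contract x t : x *m emx g (t *: x) = x.
Proof. by case: ng => [[sg _ _] /contract_leftP H]; exact: contract_ray. Qed.

Lemma normal_origin : emx g 0 = 1%:M.
Proof. by case: ng => [[sg _ _] /contract_leftP H]; exact: contract_origin. Qed.

Lemma normal_unit x : emx g x \in unitmx.
Proof.
rewrite -row_free_unit -kermx_eq0; apply/rowV0P => v /sub_kermxP vg.
apply/eqP; apply/negPn/negP => v0.
case: ng => -[_ _ /(_ x v v0)] + _.
by rewrite quadratic_formE vg mul0mx mxE ltxx.
Qed.

(** g(s x) x^T = x^T is constant in s. *)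
Lemma normal_derive_contract x t : derive_emx g x (t *: x) *m x^T = 0.
Proof.
have d1 := mx_derive_mul (mx_derive_ray x t normal_smooth) (mx_derive_cst t x^T).
rewrite mulmx0 addr0 in d1.
apply: (mx_derive_unique d1).
have -> : (fun s => emx g (s *: x) *m x^T) = fun _ => x^T.
  apply/funext => s; apply: trmx_inj.
  by rewrite trmx_mul trmxK normal_sym normal_contract.
exact: mx_derive_cst.
Qed.

Lemma solves_odeP e : smooth_field e ->
  solves_ode g e <-> emx e 0 = 1%:M /\ forall x t,
    derive_emx e x (t *: x) =
      2^-1 *: ((invmx (emx e (t *: x)))^T *m derive_emx g x (t *: x)).
Proof.
move=> se.
have dE f : smooth_field f -> forall i j x t,
    derive1 (fun s : R => f i j (s *: x)) t = derive_emx f x (t *: x) i j.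
  move=> sf i j x t; rewrite derive1E mxE.
  by have [] := is_derive_smooth_ray x t (sf i j).
have rE x t a mu : \sum_nu edual e a nu (t *: x) * derive1 (fun s : R => g nu mu (s *: x)) t
    = ((invmx (emx e (t *: x)))^T *m derive_emx g x (t *: x)) a mu.
  rewrite mxE; apply: eq_bigr => nu _; rewrite mxE dE//; exact: normal_smooth.
split=> -[H1 H2]; split.
- by apply/matrixP => a mu; rewrite !mxE H1.
- by move=> x t; apply/matrixP => a mu; rewrite -dE// H2 rE [RHS]mxE.
- by move=> a mu; have /matrixP /(_ a mu) := H1; rewrite !mxE.
- by move=> x t a mu; rewrite dE// H2 rE mxE.
Qed.

Section Solution.
Variable e : field2 R d.
Hypothesis (ve : vielbein e) (oe : solves_ode g e).

Let se : smooth_field e := ve.1.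
Let ue x : emx e x \in unitmx := ve.2 x.
Let e0 : emx e 0 = 1%:M := ((solves_odeP se).1 oe).1.
Let de x t := ((solves_odeP se).1 oe).2 x t.

(** The equation makes e^T e' symmetric and equal to g' / 2, so e^T e - g is constant on rays; it
    vanishes at the origin, where normal coordinates force g = 1. *)
Lemma solution_metric x : (emx e x)^T *m emx e x = emx g x.
Proof.
have H t : mx_derive t (fun s => (emx e (s *: x))^T *m emx e (s *: x) - emx g (s *: x)) 0.
  have dX := mx_derive_ray x t se.
  have dT := mx_derive_sub (mx_derive_mul (mx_derive_tr dX) dX)
    (mx_derive_ray x t normal_smooth).
  have X : (emx e (t *: x))^T *m derive_emx e x (t *: x) = 2^-1 *: derive_emx g x (t *: x).
    by rewrite de -scalemxAr mulmxA -trmx_mul mulVmx// trmx1 mul1mx.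
  have XT := congr1 trmx X; rewrite trmx_mul trmxK linearZ /= normal_derive_sym in XT.
  have -> // : 0 = (derive_emx e x (t *: x))^T *m emx e (t *: x) +
     (emx e (t *: x))^T *m derive_emx e x (t *: x) - derive_emx g x (t *: x).
  rewrite X XT -scalerDl.
  have -> : 2^-1 + 2^-1 = 1 :> R by field.
  by rewrite scale1r subrr.
have := mx_derive0_cst 1 0 H.
rewrite scale1r scale0r e0 trmx1 mul1mx normal_origin subrr => /eqP.
by rewrite subr_eq0 => /eqP.
Qed.

Lemma solution_contract_right x : emx e x *m x^T = x^T.
Proof.
have H t : mx_derive t (fun s => emx e (s *: x) *m x^T) 0.
  have d1 := mx_derive_mul (mx_derive_ray x t se) (mx_derive_cst t x^T).
  rewrite mulmx0 addr0 de -scalemxAl -mulmxA normal_derive_contract mulmx0 scaler0 in d1.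
  exact: d1.
by have := mx_derive0_cst 1 0 H; rewrite scale1r scale0r e0 mul1mx.
Qed.

(** Since x = x e^T, one gets x e = x e^T e = x g = x. *)
Lemma solution_contract_left x : x *m emx e x = x.
Proof.
have H : x *m (emx e x)^T = x.
  by apply: trmx_inj; rewrite trmx_mul trmxK solution_contract_right.
rewrite -{1}H -mulmxA solution_metric.
by have := normal_contract x 1; rewrite scale1r.
Qed.

(** The term +1 of the Lie derivative contributes the identity matrix, so only e' e^-1 matters for
    the symmetry. *)
Lemma iLeE f a b x : emx f x \in unitmx ->
  iLe f a b x = (derive_emx f x x *m invmx (emx f x) + 1%:M) b a.
Proof.
move=> uf; rewrite -(mulmxV uf) -mulmxDl mxE /iLe; apply: eq_bigr => mu _.
by rewrite !mxE mulrC.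
Qed.

Lemma solution_good : good_vielbein e /\ metric_of e = g.
Proof.
split; last by apply/metric_ofP; exact: solution_metric.
split => //.
- by apply/contract_rightP; exact: solution_contract_right.
- by apply/contract_leftP; exact: solution_contract_left.
move=> x a b; rewrite !iLeE// [LHS]mxE [RHS]mxE; congr (_ + _); last first.
  by rewrite !mxE eq_sym.
have := de x 1; rewrite scale1r => ->.
(* [S] is half of e^-T g' e^-1, a congruence transform of the symmetric g'. *)
set S := _ *m _.
have ST : S^T = S.
  rewrite /S -scalemxAl linearZ /= !trmx_mul trmxK normal_derive_sym.
  by rewrite mulmxA.
by rewrite -[in RHS]ST [RHS]mxE.
Qed.

Lemma solution_inv_tr x : (invmx (emx e x))^T = emx e x *m invmx (emx g x).
Proof.
rewrite -solution_metric; set E := emx e x.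
have uE : E \in unitmx by exact: ue.
have uET : E^T \in unitmx by rewrite unitmx_tr.
apply: (can_inj (mulmxK (_ : E^T *m E \in unitmx))); first by rewrite unitmx_mul uE uET.
rewrite mulmxKV ?unitmx_mul ?uE ?uET// mulmxA -trmx_mul mulmxV// trmx1 mul1mx.
by [].
Qed.

End Solution.

Lemma good_solves e : good_vielbein e -> metric_of e = g -> solves_ode g e.
Proof.
move=> [[se ue] _ /contract_leftP H2 H3] /metric_ofP eg.
apply/solves_odeP => //; split; first exact: contract_origin.
move=> x t.
(* e^T e' = e^T (e' e^-1) e is congruent to e' e^-1, so it inherits the symmetry; then g' = X^T + X
   = 2 X is the equation. *)
pose X s := (emx e (s *: x))^T *m derive_emx e x (s *: x).
have S y : (derive_emx e y y *m invmx (emx e y))^T = derive_emx e y y *m invmx (emx e y).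
  apply/matrixP => a b; rewrite [LHS]mxE.
  have := H3 y a b; rewrite !iLeE// [LHS]mxE [RHS]mxE.
  by rewrite [1%:M b a]mxE [1%:M a b]mxE eq_sym => /addIr.
(* The hypothesis at s x concerns s times the ray derivative, whence the division by s. *)
have Xsym0 s : s != 0 -> (X s)^T = X s.
  move=> s0; have := S (s *: x); rewrite (derive_emxZ x _ s se) => HS.
  apply: (scalerI s0).
  have sX : s *: X s = (emx e (s *: x))^T *m
      ((s *: derive_emx e x (s *: x)) *m invmx (emx e (s *: x))) *m emx e (s *: x).
    by rewrite mulmxA mulmxKV// /X -scalemxAr.
  have -> : s *: (X s)^T = (s *: X s)^T by rewrite linearZ.
  by rewrite sX trmx_mul trmx_mul trmxK HS mulmxA.
have Xc i j : continuous (fun s => X s i j).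
  move=> s; under [F in continuous_at _ F]eq_fun do rewrite mxE.
  apply: cvg_sumr => a; apply: cvgM.
    under eq_fun do rewrite !mxE; rewrite !mxE.
    exact: (continuous_ray (smooth_continuous (se a i))).
  under eq_fun do rewrite !mxE; rewrite !mxE.
  exact: (@continuous_derive_ray R d (e a j) x (se a j) s).
have Xsym : (X t)^T = X t.
  have [->|/Xsym0 //] := eqVneq t 0.
  apply/matrixP => i j; rewrite mxE.
  apply: (continuous_eq_at0 (Xc j i) (Xc i j)) => s s0.
  by rewrite -[in RHS](Xsym0 s s0) [RHS]mxE.
have dX := mx_derive_ray x t se.
have dM := mx_derive_mul (mx_derive_tr dX) dX.
have dG : derive_emx g x (t *: x) = (X t)^T + X t.
  apply: (mx_derive_unique (mx_derive_ray x t normal_smooth)).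
  rewrite {1}/X trmx_mul trmxK.
  have <- // : (fun s => (emx e (s *: x))^T *m emx e (s *: x)) = fun s => emx g (s *: x).
  by apply/funext => s; rewrite eg.
have XX : X t + X t = 2 *: X t by rewrite scaler_nat mulr2n.
rewrite dG Xsym XX -scalemxAr scalerA mulVf ?pnatr_eq0// scale1r.
by rewrite /X mulmxA -trmx_mul mulmxV// trmx1 mul1mx.
Qed.

(** * The linear equation for the rows: uniqueness and existence *)

Let ginv : field2 R d := fun i j x => invmx (emx g x) i j.

Let ginvE x : emx ginv x = invmx (emx g x).
Proof. by apply/matrixP => i j; rewrite mxE. Qed.

Let ginv_smooth : smooth_field ginv.
Proof.
move=> i j; apply: smooth_invmx => [x|k l]; first exact: normal_unit.
by under eq_fun do rewrite mxE; exact: normal_smooth.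
Qed.

(* On a solution e^-T = e g^-1, so that the equation reads e' = e g^-1 g' / 2:
   it is linear, and decouples the rows of e. *)
Definition row_coef (mu nu : 'I_d) (t : R) (x : V) : R :=
  2^-1 * \sum_rho invmx (emx g (t *: x)) nu rho *
    \sum_i Defs.coord x i * 'D_(basisv R i) (g rho mu) (t *: x).

Lemma row_coefE mu nu t x : row_coef mu nu t x =
  (2^-1 *: (invmx (emx g (t *: x)) *m derive_emx g x (t *: x))) nu mu.
Proof.
rewrite !mxE; congr (_ * _); apply: eq_bigr => rho _; congr (_ * _).
by rewrite mxE smooth_deriveE//; exact: normal_smooth.
Qed.

Lemma row_coef_family k mu nu : Ck_family k (row_coef mu nu).
Proof.
apply: Ck_familyM; first exact: Ck_family_cst.
apply: Ck_family_sum => rho; apply: Ck_familyM.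
  exact: (Ck_family_scaled (ginv_smooth nu rho k)).
apply: Ck_family_sum => i; apply: Ck_familyM; first exact: Ck_family_coord.
exact: (Ck_family_scaled (smooth_partial i (normal_smooth rho mu) k)).
Qed.

Lemma row_coef_continuous mu nu x : continuous (row_coef mu nu ^~ x).
Proof.
apply: jointly_continuousl.
exact: Ck_family_continuous (row_coef_family 0 mu nu).
Qed.

(** This is the invariance of the equation under reparametrizing a ray, t x being run through t
    times as fast as x. *)
Lemma row_coefZ mu nu s t x : row_coef mu nu s (t *: x) = t * row_coef mu nu (s * t) x.
Proof.
by rewrite !row_coefE scalerA (derive_emxZ x _ t normal_smooth) -scalemxAr !mxE mulrCA.
Qed.

(** A solution of the nonlinear equation thus falls under linear uniqueness, row by row. *)
Lemma solution_rows e a x : vielbein e -> solves_ode g e ->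
  linear_solution (fun mu nu => row_coef mu nu ^~ x) (fun mu t => e a mu (t *: x)).
Proof.
move=> ve oe mu t.
have := mx_derive_ray x t ve.1 a mu; under eq_fun do rewrite mxE.
move=> d1; apply: (is_derive_eq d1).
have [_ ->] := (solves_odeP ve.1).1 oe.
rewrite (solution_inv_tr ve oe) -mulmxA scalemxAr mxE; apply: eq_bigr => nu _.
by rewrite row_coefE [LHS]mulrC; congr (_ * _); rewrite mxE.
Qed.

Lemma solution_unique e1 e2 : vielbein e1 -> solves_ode g e1 ->
  vielbein e2 -> solves_ode g e2 -> e1 = e2.
Proof.
move=> v1 o1 v2 o2; apply/funext => a; apply/funext => mu; apply/funext => x.
have := linear_solution_unique (fun mu nu => @row_coef_continuous mu nu x)
  (solution_rows a x v1 o1) (solution_rows a x v2 o2).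
move=> H; have {}H := congr1 (fun h : 'I_d -> R -> R => h mu 1) (H _).
rewrite /= scale1r in H; apply: H => nu.
by rewrite scale0r o1.1 o2.1.
Qed.

Lemma solution_exists : exists e, vielbein e /\ solves_ode g e.
Proof.
have /choice [y Hy] : forall ax : 'I_d * V, exists y : 'I_d -> R -> R,
    (forall mu, y mu 0 = (ax.1 == mu)%:R) /\
    linear_solution (fun mu nu => row_coef mu nu ^~ ax.2) y.
  by move=> [a x]; apply: linear_solution_exists => mu nu; exact: row_coef_continuous.
(* Time 1 on the ray through x reaches x itself. *)
pose e : field2 R d := fun a mu x => y (a, x) mu 1.
have se : smooth_field e.
  move=> a mu k.
  exact: (Ck_family_at 1 (@Ck_family_solution R d k _ row_coef
    (fun mu t x => y (a, x) mu t) (fun mu => (a == mu)%:R) (row_coef_family k)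
    (fun mu x => (Hy (a, x)).1 mu) (fun x => (Hy (a, x)).2) mu)).
(* Both s |-> y(s, t x) and s |-> y(s t, x) solve the system at t x with the same initial value; at
   s = 1 this recovers the whole ray. *)
have ye a mu x t : e a mu (t *: x) = y (a, x) mu t.
  have H : linear_solution (fun mu nu => row_coef mu nu ^~ (t *: x))
      (fun mu s => y (a, x) mu (s * t)).
    move=> nu s; have dt : is_derive s 1 (fun s => s * t) t.
      apply: (is_derive_eq (is_derive_mulr (is_derive_id s 1) (is_derive_cst t s 1))).
      by rewrite mul1r mulr0 addr0.
    apply: (is_derive_eq (@is_derive1_comp R (y (a, x) nu) (fun s => s * t) s _ t
      ((Hy (a, x)).2 nu (s * t)) dt)).
    rewrite mulr_suml; apply: eq_bigr => rho _.
    by rewrite row_coefZ mulrC mulrA.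
  have := linear_solution_unique (fun mu nu => @row_coef_continuous mu nu (t *: x))
    (Hy (a, t *: x)).2 H.
  move=> {}H; have {}H := congr1 (fun h : 'I_d -> R -> R => h mu 1) (H _).
  rewrite /= mul1r in H; apply: H => nu.
  by rewrite mul0r (Hy (a, t *: x)).1 (Hy (a, x)).1.
have e0 : emx e 0 = 1%:M.
  by apply/matrixP => a mu; rewrite !mxE -(scale0r 0) ye (Hy (a, 0)).1.
pose G x := invmx (emx g x).
have de x t : derive_emx e x (t *: x) =
    2^-1 *: (emx e (t *: x) *m G (t *: x) *m derive_emx g x (t *: x)).
  apply: (mx_derive_unique (mx_derive_ray x t se)) => a mu.
  have -> : (fun s => emx e (s *: x) a mu) = y (a, x) mu.
    by apply/funext => s; rewrite mxE ye.
  apply: (is_derive_eq ((Hy (a, x)).2 mu t)).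
  rewrite -mulmxA scalemxAr mxE; apply: eq_bigr => nu _.
  by rewrite row_coefE [RHS]mulrC; congr (_ * _); rewrite mxE ye.
have GT x : (G x)^T = G x by rewrite /G trmx_inv normal_sym.
have uG x : emx g x \in unitmx by exact: normal_unit.
(* (g^-1)' = - g^-1 g' g^-1 makes the derivative of e g^-1 e^T vanish. *)
have eGe x : emx e x *m G x *m (emx e x)^T = 1%:M.
  have H t : mx_derive t (fun s => emx e (s *: x) *m G (s *: x) *m (emx e (s *: x))^T) 0.
    have dG : mx_derive t (fun s => G (s *: x)) (derive_emx ginv x (t *: x)).
      have := mx_derive_ray x t ginv_smooth.
      by under eq_fun do rewrite ginvE.
    have dGE : derive_emx ginv x (t *: x) =
        - (G (t *: x) *m derive_emx g x (t *: x) *m G (t *: x)).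
      have d1 := mx_derive_mul (mx_derive_ray x t normal_smooth) dG.
      have d0 : derive_emx g x (t *: x) *m G (t *: x) +
          emx g (t *: x) *m derive_emx ginv x (t *: x) = 0.
        apply: (mx_derive_unique d1).
        have -> : (fun s => emx g (s *: x) *m G (s *: x)) = fun _ => 1%:M.
          by apply/funext => s; rewrite mulmxV.
        exact: mx_derive_cst.
      apply/eqP; rewrite -addr_eq0 addrC -mulmxA.
      have -> : derive_emx ginv x (t *: x) =
          G (t *: x) *m (emx g (t *: x) *m derive_emx ginv x (t *: x)).
        by rewrite mulKmx.
      by rewrite -mulmxDr d0 mulmx0.
    have dX := mx_derive_ray x t se.
    have := mx_derive_mul (mx_derive_mul dX dG) (mx_derive_tr dX).
    have -> // : (derive_emx e x (t *: x) *m G (t *: x) +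
      emx e (t *: x) *m derive_emx ginv x (t *: x)) *m (emx e (t *: x))^T +
      emx e (t *: x) *m G (t *: x) *m (derive_emx e x (t *: x))^T = 0.
    rewrite de dGE linearZ /= !trmx_mul normal_derive_sym GT mulmxDl.
    rewrite mulmxN mulNmx -!scalemxAl -scalemxAr !mulmxA.
    set W := _ *m (emx e (t *: x))^T.
    rewrite addrAC -scalerDl.
    have -> : 2^-1 + 2^-1 = 1 :> R by field.
    by rewrite scale1r subrr.
  have := mx_derive0_cst 1 0 H.
  rewrite scale1r scale0r e0 trmx1 mul1mx mulmx1 /G normal_origin => ->.
  by rewrite invmx1.
(* Invertibility comes only now: G e^T is a right inverse of the square matrix e. *)
have ue x : emx e x \in unitmx.
  by have := eGe x; rewrite -mulmxA => /mulmx1_unit [].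
have iE x : (invmx (emx e x))^T = emx e x *m G x.
  have := eGe x; rewrite -mulmxA => /(congr1 (mulmx (invmx (emx e x)))).
  rewrite mulKmx// mulmx1 => <-.
  by rewrite trmx_mul trmxK GT.
exists e; split; first by [].
apply/solves_odeP => //; split => // x t.
by rewrite iE de.
Qed.

End NormalMetric.

End Fields.

Theorem theorem3 (R : realType) (d : nat) :
  (* the map e |-> g lands in metrics in normal coordinates *)
  (forall e : field2 R d, good_vielbein e -> normal_metric (metric_of e)) /\
  (* and is a bijection onto them *)
  (forall g : field2 R d, normal_metric g ->
     exists! e : field2 R d, good_vielbein e /\ metric_of e = g) /\
  (* the ODE has a unique vielbein solution for each such g *)
  (forall g : field2 R d, normal_metric g ->
     exists! e : field2 R d, vielbein e /\ solves_ode g e) /\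
  (* and that solution is the inverse image of g *)
  (forall g e : field2 R d, normal_metric g -> vielbein e -> solves_ode g e ->
     good_vielbein e /\ metric_of e = g).
Proof.
split; first exact: good_vielbein_normal.
split; [|split].
- move=> g ng; have [e [ve oe]] := solution_exists ng.
  exists e; split; first exact: solution_good.
  (* Any other preimage of g solves the same equation, so uniqueness of solutions gives
     injectivity. *)
  move=> e' [ge' eg]; have [ve' _ _ _] := ge'.
  exact: (solution_unique ng ve oe ve' (good_solves ng ge' eg)).
- move=> g ng; have [e [ve oe]] := solution_exists ng.
  exists e; split => // e' [ve' oe'].
  exact: (solution_unique ng).
- by move=> g e ng ve oe; exact: solution_good.
Qed.
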